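(* Let $k$ be an algebraically closed field of characteristic $0$ and let $n\ge 3$. Every singular cubic hypersurface $X\subset\mathbb{P}^n_k$ is $\mathbb{L}$-rational, i.e. $[X]\equiv 1\pmod{\mathbb{L}}$ in $K_0(\mathrm{Var}_k)$. Here a singular cubic hypersurface is the zero set of a nonzero homogeneous polynomial $F\in k[x_0,\dots,x_n]$ of degree $3$ for which there is a point of $\mathbb{P}^n_k$ at which $F$ and all its first partial derivatives vanish.
   Context: $K_0(\mathrm{Var}_k)$ is the Grothendieck ring of varieties over $k$: the abelian group generated by isomorphism classes $[X]$ of $k$-varieties (not necessarily irreducible), modulo $[X]=[Y]+[X\setminus Y]$ for every closed subvariety $Y\subseteq X$, with product $[X]\cdot[Y]=[X\times_k Y]$. $\mathbb{L}=[\mathbb{A}^1_k]$. A $k$-variety $X$ is called $\mathbb{L}$-rational if $[X]-1$ lies in the ideal $(\mathbb{L})\subset K_0(\mathrm{Var}_k)$. Zero loci in projective space are considered as sets of zeros (reduced structure). *)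

(* Defs.v *)
From HB Require Import structures.
From mathcomp Require Import all_boot all_order all_algebra.
From mathcomp Require Import boolp classical_sets.
From mathcomp Require Import mpoly.
From Stdlib Require Ring_theory RelationClasses.

Set Implicit Arguments.
Unset Strict Implicit.
Unset Printing Implicit Defensive.

Import GRing.Theory.

Local Open Scope classical_set_scope.
Local Open Scope ring_scope.

(** Over an algebraically closed field a k-variety (a reduced separated scheme
    of finite type, possibly reducible) is the same thing as a variety in the
    sense of Serre: its closed points with the Zariski topology and the sheaf
    of k-valued regular functions, covered by finitely many affine open sets.

    [fspace] is the ambient notion of space with functions. A function that is
    regular on [U] is represented by a total function whose values outside [U]
    are irrelevant ([reg_ext]); [reg U] only has a meaning for [U] open. *)
Record fspace (k : closedFieldType) := FSpace {
  point :> Type;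
  opens : set (set point);
  reg : set point -> set (point -> k);
  opens_setT : opens setT;
  opens_setI : forall U V, opens U -> opens V -> opens (U `&` V);
  opens_bigcup : forall C : set (set point),
    C `<=` opens -> opens (\bigcup_(U in C) U);
  reg_ext : forall U f g, (forall x, U x -> f x = g x) -> reg U f -> reg U g;
  reg_sub : forall U V f, opens U -> opens V -> V `<=` U -> reg U f -> reg V f;
  reg_glue : forall U f, opens U ->
    (forall x, U x -> exists V, [/\ opens V, V x, V `<=` U & reg V f]) ->
    reg U f;
  reg_cst : forall U c, opens U -> reg U (fun=> c);
  reg_add : forall U f g, opens U -> reg U f -> reg U g ->
    reg U (fun x => f x + g x);
  reg_mul : forall U f g, opens U -> reg U f -> reg U g ->
    reg U (fun x => f x * g x);
  reg_nonzero : forall U f, opens U -> reg U f ->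
    opens (U `&` [set x | f x != 0]);
  reg_inv : forall U f, opens U -> reg U f ->
    reg (U `&` [set x | f x != 0]) (fun x => (f x)^-1)
}.
Arguments opens {k} X : rename.
Arguments reg {k} X : rename.

Section Spaces.
Variable k : closedFieldType.
Implicit Types X Y Z : fspace k.

Definition closeds X (A : set X) := opens X (~` A).

Definition morphism X Y (f : X -> Y) :=
  (forall V, opens Y V -> opens X (f @^-1` V)) /\
  (forall V h, opens Y V -> reg Y V h -> reg X (f @^-1` V) (h \o f)).

Definition isomorphic X Y := exists (f : X -> Y) (g : Y -> X),
  [/\ morphism f, morphism g, cancel f g & cancel g f].

Lemma opens_local X (U : set X) :
  (forall x, U x -> exists V, [/\ opens X V, V x & V `<=` U]) -> opens X U.
Proof.
move=> H; set C := [set V | opens X V /\ V `<=` U].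
have -> : U = \bigcup_(V in C) V.
  apply/seteqP; split=> [x Ux|x [V [_ sVU] Vx]]; last exact: sVU.
  by have [V [oV Vx sVU]] := H x Ux; exists V.
by apply: opens_bigcup => V [].
Qed.

Lemma opens_set0 X : opens X set0.
Proof. by apply: opens_local. Qed.

(** The structure induced on a subset. For [A] open these are the restrictions
    to the open subsets of [A]; for [A] closed this is the reduced structure. *)
Section Subspace.
Variables (X : fspace k) (A : set X).
Let T : Type := {x : X | A x}.

Definition sub_opens : set (set T) :=
  [set W | exists U, opens X U /\ W = [set x | U (sval x)]].

Definition sub_reg (W : set T) : set (T -> k) :=
  [set f | forall x, W x -> exists U g,
    [/\ opens X U, reg X U g, U (sval x) &
        forall y, W y -> U (sval y) -> f y = g (sval y)]].

Lemma sub_opens_local (W : set T) :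
  (forall x, W x -> exists V, [/\ sub_opens V, V x & V `<=` W]) -> sub_opens W.
Proof.
move=> H; set C := [set U | opens X U /\ [set x : T | U (sval x)] `<=` W].
exists (\bigcup_(U in C) U); split; first by apply: opens_bigcup => U [].
apply/seteqP; split=> [x Wx|x [U [_ sUW] Ux]]; last exact: sUW.
have [V [[U [oU ->]] Ux sVW]] := H x Wx.
by exists U.
Qed.

Lemma sub_opensI U V : sub_opens U -> sub_opens V -> sub_opens (U `&` V).
Proof.
move=> [U' [oU ->]] [V' [oV ->]]; exists (U' `&` V'); split=> //.
exact: opens_setI.
Qed.

Lemma sub_reg_nonzero U f : sub_opens U -> sub_reg U f ->
  sub_opens (U `&` [set x | f x != 0]).
Proof.
move=> oU rf; apply: sub_opens_local => x [Ux fx0].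
have [V [g [oV rg Vx fg]]] := rf x Ux.
exists (U `&` [set y | (V `&` [set z | g z != 0]) (sval y)]); split.
- apply: sub_opensI => //; exists (V `&` [set z | g z != 0]); split=> //.
  exact: reg_nonzero.
- by split=> //; split=> //=; rewrite -fg.
- by move=> y [Uy [Vy gy0]]; split=> //=; rewrite fg.
Qed.

Lemma sub_reg_comb (op : k -> k -> k) :
  (forall U g h, opens X U -> reg X U g -> reg X U h ->
     reg X U (fun x => op (g x) (h x))) ->
  forall U f g, sub_reg U f -> sub_reg U g ->
    sub_reg U (fun x => op (f x) (g x)).
Proof.
move=> Hop U f g rf rg x Ux.
have [V [f' [oV rf' Vx ff']]] := rf x Ux.
have [W [g' [oW rg' Wx gg']]] := rg x Ux.
have oVW : opens X (V `&` W) by apply: opens_setI.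
exists (V `&` W), (fun x => op (f' x) (g' x)); split=> //.
- apply: Hop => //.
    by apply: reg_sub rf' => //; apply: subIsetl.
  by apply: reg_sub rg' => //; apply: subIsetr.
- by move=> y Uy [Vy Wy]; rewrite ff' ?gg'.
Qed.

Definition subspace : fspace k.
Proof.
refine (@FSpace k T sub_opens sub_reg _ sub_opensI _ _ _ _ _ _ _
  sub_reg_nonzero _).
- by exists setT; split=> //; apply: opens_setT.
- move=> C sC; apply: sub_opens_local => x [W CW Wx].
  exists W; split=> //; first exact: sC.
  by move=> y Wy; exists W.
- move=> U f g fg rf x Ux; have [V [h [oV rh Vx fh]]] := rf x Ux.
  by exists V, h; split=> // y Uy Vy; rewrite -fg // fh.
- move=> U V f oU oV sVU rf x Vx.
  have [W [h [oW rh Wx fh]]] := rf x (sVU _ Vx).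
  by exists W, h; split=> // y Vy Wy; rewrite fh //; apply: sVU.
- move=> U f oU H x Ux; have [V [[V' [oV' ->]] Vx sVU rf]] := H x Ux.
  have [W [h [oW rh Wx fh]]] := rf x Vx.
  have oVW : opens X (V' `&` W) by apply: opens_setI.
  exists (V' `&` W), h; split=> //.
    by apply: reg_sub rh => //; apply: subIsetr.
  by move=> y Uy [Vy Wy]; apply: fh.
- move=> U c oU x Ux; exists setT, (fun=> c); split=> //.
    exact: opens_setT.
  exact/reg_cst/opens_setT.
- by move=> U f g _; apply: (sub_reg_comb (@reg_add k X)).
- by move=> U f g _; apply: (sub_reg_comb (@reg_mul k X)).
- move=> U f oU rf x [Ux fx0]; have [V [g [oV rg Vx fg]]] := rf x Ux.
  exists (V `&` [set z | g z != 0]), (fun z => (g z)^-1); split.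
  + exact: reg_nonzero.
  + exact: reg_inv.
  + by split=> //=; rewrite -fg.
  + by move=> y [Uy _] [Vy _]; rewrite fg.
Defined.

End Subspace.

Section Affine.
Variable n : nat.
Implicit Types (U : set 'rV[k]_n) (p q : {mpoly k[n]}).

Definition peval p (x : 'rV[k]_n) : k := p.@[fun i => x ord0 i].

Definition aff_opens : set (set 'rV[k]_n) :=
  [set U | exists S : set {mpoly k[n]},
    U = [set x | exists2 p, S p & peval p x != 0]].

Definition aff_reg U : set ('rV[k]_n -> k) :=
  [set f | forall x, U x -> exists p q, peval q x != 0 /\
    forall y, U y -> peval q y != 0 -> f y = peval p y / peval q y].

Lemma pevalM p q x : peval (p * q) x = peval p x * peval q x.
Proof. by rewrite /peval mevalM. Qed.

Lemma pevalD p q x : peval (p + q) x = peval p x + peval q x.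
Proof. by rewrite /peval mevalD. Qed.

Lemma pevalC c x : peval c%:MP x = c.
Proof. by rewrite /peval mevalC. Qed.

Lemma aff_opensP U : aff_opens U <->
  (forall x, U x -> exists p,
     peval p x != 0 /\ forall y, peval p y != 0 -> U y).
Proof.
split=> [[S ->] x [p Sp px]|H].
  by exists p; split=> // y py; exists p.
exists [set p | forall y, peval p y != 0 -> U y].
apply/seteqP; split=> [x Ux|x [p Hp px]]; last exact: Hp.
by have [p [px Hp]] := H x Ux; exists p.
Qed.

Lemma aff_opensI U V : aff_opens U -> aff_opens V -> aff_opens (U `&` V).
Proof.
move=> /aff_opensP oU /aff_opensP oV; apply/aff_opensP => x [Ux Vx].
have [p [px Hp]] := oU x Ux; have [q [qx Hq]] := oV x Vx.
exists (p * q); rewrite pevalM mulf_neq0 //; split=> // y.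
by rewrite pevalM mulf_eq0 negb_or => /andP[/Hp ? /Hq ?].
Qed.

Lemma aff_reg_nonzero U f : aff_opens U -> aff_reg U f ->
  aff_opens (U `&` [set x | f x != 0]).
Proof.
move=> /aff_opensP oU rf; apply/aff_opensP => x [Ux fx0].
have [s [sx Hs]] := oU x Ux; have [p [q [qx Hf]]] := rf x Ux.
exists (s * (p * q)); rewrite !pevalM; split.
  rewrite !mulf_neq0 //; apply: contraNneq fx0 => px0.
  by rewrite Hf // px0 mul0r.
move=> y; rewrite !pevalM !mulf_eq0 !negb_or => /and3P[/Hs Uy py qy].
by split=> //=; rewrite Hf // mulf_neq0 ?invr_eq0.
Qed.

Definition affine_space : fspace k.
Proof.
refine (@FSpace k 'rV[k]_n aff_opens aff_reg _ aff_opensI _ _ _ _ _ _ _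
  aff_reg_nonzero _).
- apply/aff_opensP => x _; exists 1%:MP; split=> //.
  by rewrite pevalC oner_neq0.
- move=> C sC; apply/aff_opensP => x [U CU Ux].
  have /aff_opensP/(_ x Ux)[p [px Hp]] := sC _ CU.
  by exists p; split=> // y /Hp Uy; exists U.
- move=> U f g fg rf x Ux; have [p [q [qx Hf]]] := rf x Ux.
  by exists p, q; split=> // y Uy qy; rewrite -fg // Hf.
- move=> U V f _ _ sVU rf x Vx; have [p [q [qx Hf]]] := rf x (sVU _ Vx).
  by exists p, q; split=> // y /sVU; apply: Hf.
- move=> U f _ H x Ux; have [V [/aff_opensP oV Vx sVU rf]] := H x Ux.
  have [s [sx Hs]] := oV x Vx; have [p [q [qx Hf]]] := rf x Vx.
  exists (s * p), (s * q); rewrite pevalM mulf_neq0 //; split=> // y Uy.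
  rewrite !pevalM mulf_eq0 negb_or => /andP[sy qy].
  by rewrite -mulf_div divff // mul1r Hf //; apply: Hs.
- move=> U c _ x Ux; exists c%:MP, 1%:MP; rewrite pevalC oner_neq0.
  by split=> // y _ _; rewrite !pevalC divr1.
- move=> U f g _ rf rg x Ux.
  have [p [q [qx Hf]]] := rf x Ux; have [r [s [sx Hg]]] := rg x Ux.
  exists (p * s + r * q), (q * s); rewrite pevalM mulf_neq0 //; split=> // y Uy.
  rewrite pevalD !pevalM mulf_eq0 negb_or => /andP[qy sy].
  by rewrite Hf // Hg // addf_div.
- move=> U f g _ rf rg x Ux.
  have [p [q [qx Hf]]] := rf x Ux; have [r [s [sx Hg]]] := rg x Ux.
  exists (p * r), (q * s); rewrite pevalM mulf_neq0 //; split=> // y Uy.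
  rewrite !pevalM mulf_eq0 negb_or => /andP[qy sy].
  by rewrite Hf // Hg // mulf_div.
- move=> U f _ rf x [Ux fx0]; have [p [q [qx Hf]]] := rf x Ux.
  exists (q * q), (p * q); rewrite pevalM; split.
    rewrite mulf_neq0 //; apply: contraNneq fx0 => px0.
    by rewrite Hf // px0 mul0r.
  move=> y [Uy _]; rewrite !pevalM mulf_eq0 negb_or => /andP[py qy].
  by rewrite Hf // invf_div -mulf_div divff // mulr1.
Defined.

Definition affine_locus (S : set {mpoly k[n]}) : fspace k :=
  @subspace affine_space [set x | forall p, S p -> peval p x = 0].

End Affine.

Definition is_affine X := exists n (S : set {mpoly k[n]}),
  isomorphic X (affine_locus S).

Definition is_prevariety X := exists m (U : 'I_m -> set X),
  (forall i, opens X (U i) /\ is_affine (subspace (U i))) /\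
  forall x, exists i, U i x.

Definition separated X := forall Z, is_prevariety Z ->
  forall f g : Z -> X, morphism f -> morphism g -> closeds [set z | f z = g z].

Definition is_variety X := is_prevariety X /\ separated X.

Section Projective.
Variable n : nat.
Implicit Types (p q : {mpoly k[n.+1]}).

Definition proj_point := {L : {vspace 'rV[k]_n.+1} | \dim L == 1%N}.
Implicit Types (x y : proj_point) (U : set proj_point).

(** The value of a polynomial at a chosen vector of homogeneous coordinates:
    whether it vanishes, and quotients of two homogeneous polynomials of the
    same degree, do not depend on the choice; see [heval_line]. *)
Definition hcoord x : 'rV[k]_n.+1 := vpick (sval x).
Definition heval p x : k := peval p (hcoord x).

Definition proj_opens : set (set proj_point) :=
  [set U | exists S : set {mpoly k[n.+1]},
    (forall p, S p -> exists d, p \is d.-homog) /\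
    U = [set x | exists2 p, S p & heval p x != 0]].

Definition proj_reg U : set (proj_point -> k) :=
  [set f | forall x, U x -> exists d p q,
    [/\ p \is d.-homog, q \is d.-homog, heval q x != 0 &
        forall y, U y -> heval q y != 0 -> f y = heval p y / heval q y]].

Lemma hcoord_neq0 x : hcoord x != 0.
Proof. by rewrite vpick0 -dimv_eq0 (eqP (svalP x)). Qed.

Lemma line_hcoord x : sval x = <[hcoord x]>%VS.
Proof.
apply/esym/eqP; rewrite eqEdim -memvE memv_pick /=.
by rewrite (eqP (svalP x)) dim_vline hcoord_neq0.
Qed.

Lemma peval_scale d p c (v : 'rV[k]_n.+1) :
  p \is d.-homog -> peval p (c *: v) = c ^+ d * peval p v.
Proof.
move=> /dhomogP hp; rewrite /peval !mevalE mulr_sumr.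
apply: eq_big_seq => m /hp hm; rewrite mulrCA; congr (_ * _).
rewrite -hm /= mdegE -prodrXr -big_split /=.
by apply: eq_bigr => i _; rewrite mxE exprMn.
Qed.

Lemma heval_line d p x (v : 'rV[k]_n.+1) : p \is d.-homog ->
  v \in sval x -> v != 0 ->
  exists2 c, c != 0 & peval p v = c ^+ d * heval p x.
Proof.
move=> hp; rewrite line_hcoord => /vlineP[c ->].
rewrite scaler_eq0 negb_or => /andP[c0 _].
by exists c => //; rewrite (peval_scale _ _ hp).
Qed.

Lemma hevalM p q x : heval (p * q) x = heval p x * heval q x.
Proof. exact: pevalM. Qed.

Lemma hevalD p q x : heval (p + q) x = heval p x + heval q x.
Proof. exact: pevalD. Qed.

Lemma hevalC c x : heval c%:MP x = c.
Proof. exact: pevalC. Qed.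

Lemma dhomogC c : (c%:MP : {mpoly k[n.+1]}) \is 0.-homog.
Proof. by rewrite -[c]mulr1 mpolyCM mul_mpolyC dhomogZ // dhomog1. Qed.

Lemma proj_opensP U : proj_opens U <->
  (forall x, U x -> exists d p, [/\ p \is d.-homog,
     heval p x != 0 & forall y, heval p y != 0 -> U y]).
Proof.
split=> [[S [hS ->]] x [p Sp px]|H].
  by have [d hp] := hS p Sp; exists d, p; split=> // y py; exists p.
exists [set p | (exists d, p \is d.-homog) /\ forall y, heval p y != 0 -> U y].
split=> [p []//|]; apply/seteqP; split=> [x Ux|x [p [_ Hp] px]]; last exact: Hp.
by have [d [p [hp px Hp]]] := H x Ux; exists p => //; split=> //; exists d.
Qed.

Lemma proj_opensI U V : proj_opens U -> proj_opens V -> proj_opens (U `&` V).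
Proof.
move=> /proj_opensP oU /proj_opensP oV; apply/proj_opensP => x [Ux Vx].
have [d [p [hp px Hp]]] := oU x Ux; have [e [q [hq qx Hq]]] := oV x Vx.
exists (d + e)%N, (p * q); rewrite hevalM mulf_neq0 // dhomogM //.
split=> // y; rewrite hevalM mulf_eq0 negb_or => /andP[/Hp ? /Hq ?]; by split.
Qed.

Lemma proj_reg_nonzero U f : proj_opens U -> proj_reg U f ->
  proj_opens (U `&` [set x | f x != 0]).
Proof.
move=> /proj_opensP oU rf; apply/proj_opensP => x [Ux fx0].
have [e [s [hs sx Hs]]] := oU x Ux; have [d [p [q [hp hq qx Hf]]]] := rf x Ux.
exists (e + (d + d))%N, (s * (p * q)); rewrite !hevalM !dhomogM //; split=> //.
  rewrite !mulf_neq0 //; apply: contraNneq fx0 => px0.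
  by rewrite Hf // px0 mul0r.
move=> y; rewrite !hevalM !mulf_eq0 !negb_or => /and3P[/Hs Uy py qy].
by split=> //=; rewrite Hf // mulf_neq0 ?invr_eq0.
Qed.

Definition proj_space : fspace k.
Proof.
refine (@FSpace k proj_point proj_opens proj_reg _ proj_opensI _ _ _ _ _ _ _
  proj_reg_nonzero _).
- apply/proj_opensP => x _; exists 0%N, 1%:MP.
  by split; rewrite ?dhomogC // hevalC oner_neq0.
- move=> C sC; apply/proj_opensP => x [U CU Ux].
  have /proj_opensP/(_ x Ux)[d [p [hp px Hp]]] := sC _ CU.
  by exists d, p; split=> // y /Hp Uy; exists U.
- move=> U f g fg rf x Ux; have [d [p [q [hp hq qx Hf]]]] := rf x Ux.
  by exists d, p, q; split=> // y Uy qy; rewrite -fg // Hf.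
- move=> U V f _ _ sVU rf x Vx.
  have [d [p [q [hp hq qx Hf]]]] := rf x (sVU _ Vx).
  by exists d, p, q; split=> // y /sVU; apply: Hf.
- move=> U f _ H x Ux; have [V [/proj_opensP oV Vx sVU rf]] := H x Ux.
  have [e [s [hs sx Hs]]] := oV x Vx; have [d [p [q [hp hq qx Hf]]]] := rf x Vx.
  exists (e + d)%N, (s * p), (s * q).
  rewrite hevalM mulf_neq0 // !dhomogM //; split=> // y Uy.
  rewrite !hevalM mulf_eq0 negb_or => /andP[sy qy].
  by rewrite -mulf_div divff // mul1r Hf //; apply: Hs.
- move=> U c _ x Ux; exists 0%N, c%:MP, 1%:MP.
  rewrite hevalC oner_neq0 !dhomogC.
  by split=> // y _ _; rewrite !hevalC divr1.
- move=> U f g _ rf rg x Ux.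
  have [d [p [q [hp hq qx Hf]]]] := rf x Ux.
  have [e [r [s [hr hs sx Hg]]]] := rg x Ux.
  exists (d + e)%N, (p * s + r * q), (q * s).
  have hrq : r * q \is (d + e)%N.-homog by rewrite addnC dhomogM.
  have hps : p * s \is (d + e)%N.-homog by apply: dhomogM.
  rewrite hevalM mulf_neq0 // dhomogD // dhomogM //; split=> // y Uy.
  rewrite hevalD !hevalM mulf_eq0 negb_or => /andP[qy sy].
  by rewrite Hf // Hg // addf_div.
- move=> U f g _ rf rg x Ux.
  have [d [p [q [hp hq qx Hf]]]] := rf x Ux.
  have [e [r [s [hr hs sx Hg]]]] := rg x Ux.
  exists (d + e)%N, (p * r), (q * s).
  rewrite hevalM mulf_neq0 // !dhomogM //; split=> // y Uy.
  rewrite !hevalM mulf_eq0 negb_or => /andP[qy sy].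
  by rewrite Hf // Hg // mulf_div.
- move=> U f _ rf x [Ux fx0]; have [d [p [q [hp hq qx Hf]]]] := rf x Ux.
  exists (d + d)%N, (q * q), (p * q); rewrite !dhomogM // hevalM; split=> //.
    rewrite mulf_neq0 //; apply: contraNneq fx0 => px0.
    by rewrite Hf // px0 mul0r.
  move=> y [Uy _]; rewrite !hevalM mulf_eq0 negb_or => /andP[py qy].
  by rewrite Hf // invf_div -mulf_div divff // mulr1.
Defined.

Definition proj_hypersurface p : fspace k :=
  @subspace proj_space [set x | heval p x = 0].

End Projective.

Lemma morphism_id X : morphism (fun x : X => x).
Proof. by split. Qed.

Lemma morphism_comp X Y Z (f : X -> Y) (g : Y -> Z) :
  morphism f -> morphism g -> morphism (g \o f).
Proof.
move=> [f1 f2] [g1 g2]; split=> [V oV|V h oV rh]; first exact: (f1 _ (g1 _ oV)).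
exact: (f2 _ _ (g1 _ oV) (g2 _ _ oV rh)).
Qed.

Lemma sval_inj X (A : set X) : injective (sval : subspace A -> X).
Proof. by move=> [x Ax] [y Ay] /= exy; subst y; rewrite (Prop_irrelevance Ax Ay). Qed.

Lemma morphism_sval X (A : set X) : morphism (sval : subspace A -> X).
Proof.
split=> [V oV|V h oV rh]; first by exists V.
by move=> x Vx; exists V, h; split.
Qed.

Lemma morphism_lift X Y (A : set Y) (f : X -> Y) (fA : forall x, A (f x)) :
  morphism f -> morphism (fun x => exist A (f x) (fA x) : subspace A).
Proof.
move=> [f1 f2].
have o1 V : opens (subspace A) V ->
    opens X ((fun x => exist A (f x) (fA x)) @^-1` V).
  by move=> [U [oU ->]]; apply: f1.
split=> // V h oV rh; apply: reg_glue; first exact: o1.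
move=> x Vx; have [U [g [oU rg Ux hg]]] := rh _ Vx.
pose W := (fun x => exist A (f x) (fA x)) @^-1` V `&` f @^-1` U.
have oW : opens X W by apply: opens_setI; [apply: o1|apply: f1].
exists W; split=> //; first exact: subIsetl.
apply: (@reg_ext _ _ _ (g \o f)) => [y [Vy Uy]|]; first by rewrite /= hg.
by apply: reg_sub (f2 _ _ oU rg) => //; [apply: f1|apply: subIsetr].
Qed.

Lemma affine_sub X n (f : X -> 'rV[k]_n) :
  (forall i, reg X setT (fun x => f x ord0 i)) ->
  morphism (f : X -> affine_space n).
Proof.
move=> rf; have oT := opens_setT X.
have rp (p : {mpoly k[n]}) : reg X setT (fun x => peval p (f x)).
  elim/mpolyind: p => [|c m p _ _ IH].
    by apply: (reg_ext _ (reg_cst 0 oT)) => x _; rewrite /peval meval0.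
  apply: (@reg_ext _ _ _ (fun x => c * (\prod_(i < n) f x ord0 i ^+ m i) +
      peval p (f x))) => [x _|].
    by rewrite pevalD /peval mevalZ mevalX.
  apply: reg_add => //; apply: reg_mul => //; first exact: reg_cst.
  have rX i e : reg X setT (fun x => f x ord0 i ^+ e).
    elim: e => [|e IHe].
      by apply: (reg_ext _ (reg_cst 1 oT)) => x _; rewrite expr0.
    by apply: (reg_ext _ (reg_mul oT (rf i) IHe)) => x _; rewrite exprS.
  elim: (index_enum _) => [|i s IHs].
    by apply: (reg_ext _ (reg_cst 1 oT)) => x _; rewrite big_nil.
  by apply: (reg_ext _ (reg_mul oT (rX i (m i)) IHs)) => x _; rewrite big_cons.
have oD (p : {mpoly k[n]}) : opens X [set x | peval p (f x) != 0].
  by have := reg_nonzero oT (rp p); rewrite setTI.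
have o1 V : aff_opens V -> opens X (f @^-1` V).
  move=> /aff_opensP oV; apply: opens_local => x Vx.
  have [p [px Hp]] := oV _ Vx.
  by exists [set y | peval p (f y) != 0]; split=> // y /Hp.
split=> // V h oV rh; apply: reg_glue; first exact: o1.
move=> x Vx; have [p [q [qx Hh]]] := rh _ Vx.
pose D := [set y | peval q (f y) != 0].
have oVD : opens X (f @^-1` V `&` D) by exact: opens_setI (o1 _ oV) (oD q).
exists (f @^-1` V `&` D); split=> //.
apply: (@reg_ext _ _ _ (fun y => peval p (f y) * (peval q (f y))^-1)).
  by move=> y [Vy Dy]; rewrite /= Hh.
apply: reg_mul => //; first exact: (reg_sub oT).
have rq := reg_inv oT (rp q); rewrite setTI in rq.
by apply: reg_sub rq => //; apply: subIsetr.
Qed.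

Lemma reg_coord n i :
  reg (affine_space n) setT (fun v : 'rV[k]_n => v ord0 i).
Proof.
move=> v _; exists 'X_i, 1%:MP; rewrite pevalC oner_neq0; split=> // w _ _.
by rewrite pevalC divr1 /peval mevalXU.
Qed.

Lemma reg_opp X U (f : X -> k) : opens X U -> reg X U f ->
  reg X U (fun x => - f x).
Proof.
move=> oU rf; apply: (reg_ext _ (reg_mul oU (reg_cst (-1) oU) rf)) => x _.
by rewrite mulN1r.
Qed.

Lemma separated_inj X Y (f : X -> Y) :
  morphism f -> injective f -> separated Y -> separated X.
Proof.
move=> mf injf sY Z pZ g h mg mh.
have -> : [set z | g z = h z] = [set z | (f \o g) z = (f \o h) z].
  by apply/seteqP; split=> z /= => [->|/injf].
by apply: sY => //; apply: morphism_comp mf.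
Qed.

Lemma affine_space_separated n : separated (affine_space n).
Proof.
move=> Z pZ f g [f1 f2] [g1 g2]; apply: opens_local => z /= fgz.
have [i fgi] : exists i, f z ord0 i != g z ord0 i.
  apply/existsP; apply: contra_notT fgz => /existsPn H.
  by apply/rowP => i; apply/eqP; have := H i; rewrite negbK.
have oT := opens_setT Z; have oT' := opens_setT (affine_space n).
have rf := f2 _ _ oT' (reg_coord i); have rg := g2 _ _ oT' (reg_coord i).
have := reg_nonzero oT (reg_add oT rf (reg_opp oT rg)); rewrite setTI => oD.
exists [set z | f z ord0 i - g z ord0 i != 0]; split=> //=.
  by rewrite subr_eq0.
by move=> w /= + fgw; rewrite fgw subrr eqxx.
Qed.

Lemma affine_space_variety n : is_variety (affine_space n).
Proof.
split; last exact: affine_space_separated.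
exists 1%N, (fun=> setT); split=> [_|v]; last by exists ord0.
split; first exact: opens_setT.
exists n, set0; pose V := [set v : affine_space n |
  forall p : {mpoly k[n]}, set0 p -> peval p v = 0].
have HV v : V v by [].
exists (fun x => exist V (sval x) (HV (sval x))).
exists (fun x => exist setT (sval x) I); split.
- exact/morphism_lift/morphism_sval.
- exact/(@morphism_lift _ (affine_space n))/morphism_sval.
- by move=> x; apply: sval_inj.
- by move=> x; apply: sval_inj.
Qed.

Section ProjectiveVariety.
Variable n : nat.
Let P := proj_space n.

Definition chart (i : 'I_n.+1) : set P := [set x : P | hcoord x ord0 i != 0].

Lemma dhomogXi (i : 'I_n.+1) : ('X_i : {mpoly k[n.+1]}) \is 1%N.-homog.
Proof. by rewrite dhomogX; apply/eqP/mdeg1. Qed.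

Lemma hevalX i (x : P) : heval 'X_i x = hcoord x ord0 i.
Proof. exact: mevalXU. Qed.

Lemma opens_chart i : opens P (chart i).
Proof.
exists [set 'X_i]; split=> [_ ->|]; first by exists 1%N; apply: dhomogXi.
apply/seteqP; split=> [x xi|x [_ -> /=]]; last by rewrite hevalX.
by exists 'X_i => //; rewrite hevalX.
Qed.

Lemma chart_cover (x : P) : exists i, chart i x.
Proof.
apply/existsP; apply: contraT => /existsPn H; case/negP: (hcoord_neq0 x).
by apply/eqP/rowP => i; rewrite mxE; apply/eqP; have := H i; rewrite negbK.
Qed.

Lemma reg_ratio i j :
  reg P (chart i) (fun x : P => hcoord x ord0 j / hcoord x ord0 i).
Proof.
move=> x xi; exists 1%N, 'X_j, 'X_i; rewrite !dhomogXi hevalX; split=> // y _ _.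
by rewrite !hevalX.
Qed.

Lemma proj_eqP (x y : P) i : chart i x ->
  (forall j, hcoord x ord0 j * hcoord y ord0 i =
             hcoord x ord0 i * hcoord y ord0 j) -> x = y.
Proof.
move=> xi H; apply: val_inj; rewrite /= !line_hcoord.
set a := hcoord x; set b := hcoord y.
have eb : b = (b ord0 i / a ord0 i) *: a.
  apply/rowP => j; rewrite mxE; apply: (mulfI xi).
  by rewrite -H mulrA [_ * (_ / _)]mulrC divfK // mulrC.
have c0 : b ord0 i / a ord0 i != 0.
  apply: contraNneq (hcoord_neq0 y) => c0.
  by rewrite -/b eb c0 scale0r.
apply/eqP; rewrite eqEdim !dim_vline !hcoord_neq0 leqnn andbT -memvE.
by apply/vlineP; exists (b ord0 i / a ord0 i)^-1; rewrite [X in _ *: X]eb scalerK.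
Qed.

Lemma proj_space_separated : separated P.
Proof.
move=> Z pZ f g [f1 f2] [g1 g2]; apply: opens_local => z /= fgz.
have [i fi] := chart_cover (f z); have [j gj] := chart_cover (g z).
have [l fgl] : exists l, hcoord (f z) ord0 l * hcoord (g z) ord0 i !=
                         hcoord (f z) ord0 i * hcoord (g z) ord0 l.
  apply/existsP; apply: contra_notT fgz => /existsPn H.
  by apply: (proj_eqP fi) => l; apply/eqP; have := H l; rewrite negbK.
pose U := f @^-1` chart i `&` g @^-1` chart j.
have oi := f1 _ (opens_chart i); have oj := g1 _ (opens_chart j).
have oU : opens Z U by apply: opens_setI.
have ru : reg Z U (fun w => hcoord (f w) ord0 l / hcoord (f w) ord0 i).
  apply: (reg_sub oi) => //; first exact: subIsetl.
  exact: (f2 _ _ (opens_chart i) (@reg_ratio i l)).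
have rv m : reg Z U (fun w => hcoord (g w) ord0 m / hcoord (g w) ord0 j).
  apply: (reg_sub oj) => //; first exact: subIsetr.
  exact: (g2 _ _ (opens_chart j) (@reg_ratio j m)).
have := reg_nonzero oU (reg_add oU (reg_mul oU ru (rv i)) (reg_opp oU (rv l))).
set D := (X in opens Z X) => oD; exists D; split=> //.
- split=> //=; rewrite subr_eq0; apply: contra fgl => /eqP H.
  apply/eqP; apply: (mulIf (invr_neq0 gj)).
  rewrite -[RHS]mulrA -H -[LHS]mulrA [RHS]mulrA; congr (_ * _).
  by rewrite [RHS]mulrC divfK.
- move=> w [[wi wj] /= H] fgw; case/negP: H; rewrite -fgw in wj *.
  by rewrite mulrA divfK // subrr.
Qed.

Section Line.
Variables (A : set (affine_space n.+1)).
Hypothesis A0 : forall v : 'rV[k]_n.+1, A v -> v != 0.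

Definition line_of (x : subspace A) : P :=
  exist _ <[sval x : 'rV[k]_n.+1]>%VS
    (introT eqP (etrans (dim_vline _) (congr1 nat_of_bool (A0 (svalP x))))).

Lemma hcoord_line x : exists2 c, c != 0 & sval x = c *: hcoord (line_of x).
Proof.
have : sval x \in sval (line_of x) by apply: memv_line.
rewrite line_hcoord => /vlineP[c ec]; exists c => //.
by apply: contraNneq (A0 (svalP x)) => c0; rewrite ec c0 scale0r.
Qed.

Lemma heval_line_of d p x : p \is d.-homog ->
  exists2 c, c != 0 & peval p (sval x) = c ^+ d * heval p (line_of x).
Proof.
by move=> hp; apply: heval_line hp _ (A0 (svalP x)); apply: memv_line.
Qed.

Lemma morphism_line : morphism line_of.
Proof.
have nz d p x : p \is d.-homog ->
    (heval p (line_of x) != 0) = (peval p (sval x) != 0).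
  by move=> /heval_line_of-/(_ x)[c c0 ->]; rewrite mulf_eq0 expf_eq0 (negPf c0) andbF.
split=> [V [S [hS ->]]|V h oV rh].
  exists [set v | exists2 p, S p & peval p v != 0]; split; first by exists S.
  apply/seteqP; split=> x [p Sp]; have [d hp] := hS p Sp;
    by [rewrite (nz d) // => ?; exists p|rewrite -(nz d) // => ?; exists p].
move=> x Vx; have [d [p [q [hp hq qx Hh]]]] := rh _ Vx.
exists [set v | peval q v != 0], (fun v => peval p v / peval q v); split.
- exists [set q]; apply/seteqP; split=> [v qv|v [_ ->]] //; by exists q.
- by move=> v qv; exists p, q; split.
- by rewrite /= -(nz d).
- move=> y Vy /= qy; rewrite Hh ?(nz d) //.
  have [c c0 ec] := hcoord_line y.
  rewrite ec !(peval_scale _ _ hp) !(peval_scale _ _ hq) -mulf_div divff ?mul1r //.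
  by rewrite expf_neq0.
Qed.

End Line.

Lemma proj_hypersurface_variety d (p : {mpoly k[n.+1]}) :
  p \is d.-homog -> is_variety (proj_hypersurface p).
Proof.
move=> hp; split; last first.
  exact: separated_inj (@morphism_sval P _) (@sval_inj P _) proj_space_separated.
set H := proj_hypersurface p.
exists n.+1, (fun i => [set x : H | chart i (sval x)]); split; last first.
  by move=> x; apply: chart_cover.
move=> i; split; first by exists (chart i); split=> //; apply: opens_chart.
pose S : set {mpoly k[n.+1]} := [set 'X_i - 1%:MP; p].
exists n.+1, S; set T := subspace _.
pose A := [set v : affine_space n.+1 | forall q, S q -> peval q v = 0].
have pXi (v : 'rV[k]_n.+1) : peval ('X_i - 1%:MP) v = v ord0 i - 1.
  by rewrite /peval mevalB mevalXU mevalC.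
have A1 (v : 'rV[k]_n.+1) : A v -> v ord0 i = 1.
  by move=> /(_ ('X_i - 1%:MP) (or_introl erefl)); rewrite pXi => /subr0_eq.
have A0 (v : 'rV[k]_n.+1) : A v -> v != 0.
  by move=> /A1 vi; apply: contra_eq_neq vi => ->; rewrite mxE eq_sym oner_neq0.
pose v (x : T) : 'rV[k]_n.+1 :=
  (hcoord (sval (sval x)) ord0 i)^-1 *: hcoord (sval (sval x)).
have vA x : A (v x).
  move=> q [->|->].
    by rewrite pXi mxE mulVf ?subrr //; apply: (svalP x).
  by rewrite (peval_scale _ _ hp) [peval _ _](svalP (sval x)) mulr0.
pose x (w : affine_locus S) : P := line_of A0 w.
have xH w : [set y : P | heval p y = 0] (x w).
  have [c c0] := heval_line_of A0 w hp.
  rewrite [LHS](svalP w p (or_intror erefl)) => /esym/eqP.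
  by rewrite mulf_eq0 expf_eq0 (negPf c0) andbF => /eqP.
have xi w : [set y : H | chart i (sval y)] (exist _ (x w) (xH w)).
  have [c c0 ec] := hcoord_line A0 w.
  have := A1 _ (svalP w); rewrite ec mxE => /eqP; rewrite /= /chart /=.
  by apply: contraTneq => ->; rewrite mulr0 eq_sym oner_neq0.
exists (fun y => exist A (v y) (vA y)).
exists (fun w => exist _ (exist _ (x w) (xH w)) (xi w)); split.
- apply: (@morphism_lift _ (affine_space n.+1)); apply: affine_sub => j.
  have [m1 m2] := morphism_comp
    (@morphism_sval H [set y : H | chart i (sval y)]) (@morphism_sval P _).
  apply: reg_ext (reg_sub (m1 _ (opens_chart i)) (opens_setT T)
    (fun y _ => svalP y) (m2 _ _ (opens_chart i) (@reg_ratio i j))) => y _.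
  by rewrite /= mxE mulrC.
- by do 2!apply: morphism_lift; apply: morphism_line.
- move=> y; apply: sval_inj; apply: sval_inj => /=; apply: val_inj => /=.
  rewrite line_hcoord; apply/eqP.
  have yi : hcoord (sval (sval y)) ord0 i != 0 by apply: (svalP y).
  rewrite eqEdim !dim_vline scaler_eq0 invr_eq0 (negPf yi) !hcoord_neq0 leqnn.
  by rewrite andbT -memvE memvZ ?memv_line.
- move=> w; apply: (@sval_inj (affine_space n.+1)) => /=.
  have [c c0 ec] := hcoord_line A0 w; rewrite /v /= -/(x w).
  have := A1 _ (svalP w); rewrite ec -/(x w) mxE => e1.
  congr (_ *: _); have x0 := xi w; rewrite /= /chart /= in x0.
  by apply: (mulIf x0); rewrite mulVf // e1.
Qed.

End ProjectiveVariety.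

(** [Z], with projections [p] and [q], is the product of [X] and [Y] in the
    category of varieties. *)
Definition is_product X Y Z (p : Z -> X) (q : Z -> Y) :=
  morphism p /\ morphism q /\
  forall T, is_variety T -> forall (f : T -> X) (g : T -> Y),
    morphism f -> morphism g ->
    exists! h : T -> Z, [/\ morphism h, p \o h = f & q \o h = g].

End Spaces.

Record variety (k : closedFieldType) := Variety {
  variety_space :> fspace k;
  variety_axiom : is_variety variety_space
}.

(** [K0 k] consists of the ring expressions in the symbols [[X]], and [K0_eq] is
    the equality of K_0(Var_k): the finest commutative ring congruence that
    contains the defining relations. The monomials in the symbols reduce to
    single symbols by [K0_eq_prod] and [K0_eq_point], and the product of a
    scissor relation with a symbol is again a scissor relation, so that the
    underlying group is the free abelian group on the isomorphism classes modulo
    the scissor relations. The subtype of a closed set and its complement carry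
    their induced structures; these are always varieties, so the two proofs
    quantified over in [K0_eq_scissor] exist. *)
Inductive K0 (k : closedFieldType) : Type :=
| K0_class of variety k
| K0_zero
| K0_one
| K0_opp of K0 k
| K0_add of K0 k & K0 k
| K0_mul of K0 k & K0 k.
Arguments K0_zero {k}.
Arguments K0_one {k}.

Inductive K0_eq (k : closedFieldType) : K0 k -> K0 k -> Prop :=
| K0_eq_iso (X Y : variety k) :
    isomorphic X Y -> K0_eq (K0_class X) (K0_class Y)
| K0_eq_scissor (X : variety k) (A : set X)
    (hA : is_variety (subspace A)) (hU : is_variety (subspace (~` A))) :
    closeds A ->
    K0_eq (K0_class X) (K0_add (K0_class (Variety hA)) (K0_class (Variety hU)))
| K0_eq_prod (X Y Z : variety k) (p : Z -> X) (q : Z -> Y) :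
    is_product p q -> K0_eq (K0_mul (K0_class X) (K0_class Y)) (K0_class Z)
| K0_eq_point : K0_eq K0_one (K0_class (Variety (affine_space_variety k 0)))
| K0_eq_refl a : K0_eq a a
| K0_eq_sym a b : K0_eq a b -> K0_eq b a
| K0_eq_trans a b c : K0_eq a b -> K0_eq b c -> K0_eq a c
| K0_eq_opp a a' : K0_eq a a' -> K0_eq (K0_opp a) (K0_opp a')
| K0_eq_add a a' b b' :
    K0_eq a a' -> K0_eq b b' -> K0_eq (K0_add a b) (K0_add a' b')
| K0_eq_mul a a' b b' :
    K0_eq a a' -> K0_eq b b' -> K0_eq (K0_mul a b) (K0_mul a' b')
| K0_eq_addC a b : K0_eq (K0_add a b) (K0_add b a)
| K0_eq_addA a b c : K0_eq (K0_add a (K0_add b c)) (K0_add (K0_add a b) c)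
| K0_eq_add0 a : K0_eq (K0_add K0_zero a) a
| K0_eq_addN a : K0_eq (K0_add a (K0_opp a)) K0_zero
| K0_eq_mulC a b : K0_eq (K0_mul a b) (K0_mul b a)
| K0_eq_mulA a b c : K0_eq (K0_mul a (K0_mul b c)) (K0_mul (K0_mul a b) c)
| K0_eq_mul1 a : K0_eq (K0_mul K0_one a) a
| K0_eq_mulD a b c :
    K0_eq (K0_mul (K0_add a b) c) (K0_add (K0_mul a c) (K0_mul b c)).

Definition K0_sub (k : closedFieldType) (a b : K0 k) := K0_add a (K0_opp b).

Lemma K0_ring (k : closedFieldType) :
  Ring_theory.ring_theory (@K0_zero k) K0_one (@K0_add k) (@K0_mul k)
    (@K0_sub k) (@K0_opp k) (@K0_eq k).
Proof. by constructor; intros; constructor. Qed.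

Lemma K0_ring_ext (k : closedFieldType) :
  Ring_theory.ring_eq_ext (@K0_add k) (@K0_mul k) (@K0_opp k) (@K0_eq k).
Proof. by constructor; repeat intro; constructor. Qed.

#[export] Instance K0_eq_equiv (k : closedFieldType) :
  RelationClasses.Equivalence (@K0_eq k).
Proof.
constructor; first exact: K0_eq_refl; first exact: K0_eq_sym.
exact: K0_eq_trans.
Qed.

Definition K0_ideal (k : closedFieldType) (a : K0 k) : K0 k -> Prop :=
  fun b => exists c, K0_eq b (K0_mul c a).

Definition lefschetz (k : closedFieldType) : K0 k :=
  K0_class (Variety (affine_space_variety k 1)).

Definition L_rational (k : closedFieldType) (X : variety k) :=
  K0_ideal (lefschetz k) (K0_sub (K0_class X) K0_one).

Definition hypersurface (k : closedFieldType) n d (F : {mpoly k[n.+1]})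
    (hF : F \is d.-homog) : variety k :=
  Variety (proj_hypersurface_variety hF).

Definition singular (k : closedFieldType) n (F : {mpoly k[n.+1]}) :=
  exists x : proj_space k n,
    heval F x = 0 /\ forall i, heval F^`M(i) x = 0.

(* Main.v *)
(** The class of a cone determines the class of its projectivization modulo
    [L]: over the part of [X = V(F)] where [x_i] is the first nonzero coordinate,
    the punctured affine cone is a product with the punctured line, whose class
    is [L - 1], so [C(F)] + [X] = 1 modulo [L] and it is enough to show that
    [C(F)] is divisible by [L].

    Suppose that [f(v + t p) = f(v) + t g(v)] for a vector [p] of the affine
    space [V]. In [V = W + k p] the zero set of [f] maps to [W] with one point
    over [g <> 0] and a line over [f = g = 0], so that
    [{f = 0}] = [W] - [{g = 0} in W] = - [{g = 0} in W] modulo [L].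
    If [f] is the cubic and [p] its singular point, [g] is a quadratic form on
    [W]; it has a nontrivial zero, and repeating the argument there replaces it
    by a linear form, and this one by [0]. *)
Require Import Defs.
From HB Require Import structures.
From mathcomp Require Import all_boot all_order all_algebra.
From mathcomp Require Import boolp classical_sets.
From mathcomp Require Import mpoly.
From Stdlib Require Import Setoid Morphisms Ring.

Import GRing.Theory.
Local Open Scope ring_scope.
Local Open Scope classical_set_scope.

Set Implicit Arguments.
Unset Strict Implicit.
Unset Printing Implicit Defensive.

(** * Isomorphisms of spaces with functions, and classes of arbitrary spaces *)

Section Isomorphisms.
Variable k : closedFieldType.
Implicit Types X Y Z : fspace k.

Lemma isomorphic_sym X Y : isomorphic X Y -> isomorphic Y X.
Proof. by move=> [f [g [mf mg fg gf]]]; exists g, f. Qed.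

Lemma isomorphic_trans X Y Z :
  isomorphic X Y -> isomorphic Y Z -> isomorphic X Z.
Proof.
move=> [f [g [mf mg fK gK]]] [f' [g' [mf' mg' fK' gK']]].
exists (f' \o f), (g \o g'); split; try exact: morphism_comp.
- exact: can_comp.
- exact: can_comp.
Qed.

Lemma isomorphic_preimage X Y (f : X -> Y) (g : Y -> X) (A : set X) (B : set Y) :
  morphism f -> morphism g ->
  (forall x, A x -> B (f x)) -> (forall y, B y -> A (g y)) ->
  (forall x, A x -> g (f x) = x) -> (forall y, B y -> f (g y) = y) ->
  isomorphic (subspace A) (subspace B).
Proof.
move=> mf mg fAB gBA fK gK.
exists (fun x : subspace A => exist B (f (sval x)) (fAB _ (svalP x)) : subspace B).
exists (fun y : subspace B => exist A (g (sval y)) (gBA _ (svalP y)) : subspace A).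
split.
- by apply: morphism_lift; apply: (morphism_comp (@morphism_sval _ X A)).
- by apply: morphism_lift; apply: (morphism_comp (@morphism_sval _ Y B)).
- by move=> x; apply: sval_inj => /=; apply: fK; apply: svalP.
- by move=> y; apply: sval_inj => /=; apply: gK; apply: svalP.
Qed.

Lemma isomorphic_setT X : isomorphic (subspace [set: X]) X.
Proof.
exists (sval : subspace [set: X] -> X), (fun x => exist setT x I : subspace [set: X]); split.
- exact: morphism_sval.
- exact/morphism_lift/morphism_id.
- by move=> x; apply: sval_inj.
- by [].
Qed.

Lemma isomorphic_subsub X (A B : set X) :
  isomorphic (subspace [set x : subspace A | B (sval x)]) (subspace (A `&` B)).
Proof.
have AB (x : subspace [set x : subspace A | B (sval x)]) :
  (A `&` B) (sval (sval x)) by split; [apply: (svalP (sval x))|apply: (svalP x)].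
have mA (y : subspace (A `&` B)) : A (sval y) by case: (svalP y).
have mB (y : subspace (A `&` B)) : B (sval y) by case: (svalP y).
exists (fun x => exist _ (sval (sval x)) (AB x) : subspace (A `&` B)).
exists (fun y => exist _ (exist A (sval y) (mA y) : subspace A) (mB y)); split.
- apply: morphism_lift; apply: (morphism_comp _ (@morphism_sval _ X A)).
  exact: morphism_sval.
- by apply/morphism_lift/morphism_lift/morphism_sval.
- by move=> x; do 2!apply: sval_inj.
- by move=> y; apply: sval_inj.
Qed.

Lemma isomorphic_affine X Y : isomorphic X Y -> is_affine Y -> is_affine X.
Proof. by move=> iXY [n [S iY]]; exists n, S; apply: isomorphic_trans iY. Qed.

Lemma isomorphic_prevariety X Y :
  isomorphic X Y -> is_prevariety Y -> is_prevariety X.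
Proof.
move=> [f [g [mf mg fK gK]]] [m [U [hU cU]]].
exists m, (fun i => f @^-1` U i); split; last by move=> x; apply: cU.
move=> i; have [oU aU] := hU i; split; first exact: mf.1.
apply: isomorphic_affine aU; apply: (isomorphic_preimage mf mg) => //.
by move=> y Uy /=; rewrite /preimage /= gK.
Qed.

Lemma isomorphic_variety X Y : isomorphic X Y -> is_variety Y -> is_variety X.
Proof.
move=> iXY [pY sY]; split; first exact: isomorphic_prevariety pY.
case: iXY => f [g [mf mg fK gK]].
exact: separated_inj mf (can_inj fK) sY.
Qed.

(** The whole space is a single affine chart, and separatedness is inherited from affine space along
    an injective morphism. *)
Lemma affine_variety X n (f : X -> affine_space k n) :
  morphism f -> injective f -> is_affine X -> is_variety X.
Proof.
move=> mf injf aX; split; last first.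
  exact: separated_inj mf injf (@affine_space_separated k n).
exists 1%N, (fun=> setT); split=> [_|x]; last by exists ord0.
split; first exact: opens_setT.
exact: isomorphic_affine (isomorphic_setT X) aX.
Qed.

(** The value at a space that is not a variety is junk. *)
Definition class_of X : K0 k :=
  if pselect (is_variety X) is left hX then K0_class (Variety hX) else K0_zero.

Lemma class_ofE (X : variety k) : class_of X = K0_class X.
Proof.
rewrite /class_of; case: pselect => [h|/(_ (variety_axiom X))//].
by case: X h => X hX h /=; congr (K0_class (Variety _)); apply: Prop_irrelevance.
Qed.

Lemma class_of_var X (hX : is_variety X) : class_of X = K0_class (Variety hX).
Proof. exact: (class_ofE (Variety hX)). Qed.

Lemma class_of_iso X Y : isomorphic X Y -> K0_eq (class_of X) (class_of Y).
Proof.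
move=> iXY; rewrite /class_of.
case: pselect => hX; case: pselect => hY; first exact: K0_eq_iso.
- by case: hY; apply: isomorphic_variety (isomorphic_sym iXY) hX.
- by case: hX; apply: isomorphic_variety iXY hY.
- exact: K0_eq_refl.
Qed.

(** The defining scissor relation of [subspace A] speaks of subspaces of a subspace. Here it is
    transported along [isomorphic_subsub] to subsets of the fixed ambient [X], so that cuts can be
    iterated. *)
Lemma class_of_scissor X (A C : set X) : closeds C ->
  is_variety (subspace A) -> is_variety (subspace (A `&` C)) ->
  is_variety (subspace (A `\` C)) ->
  K0_eq (class_of (subspace A))
    (K0_add (class_of (subspace (A `&` C))) (class_of (subspace (A `\` C)))).
Proof.
move=> cC hA hAC hAD.
pose B : set (Variety hA) := [set x | C (sval x)].
have iC : isomorphic (subspace B) (subspace (A `&` C)) by apply: isomorphic_subsub.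
have iD : isomorphic (subspace (~` B)) (subspace (A `\` C)).
  exact: (@isomorphic_subsub X A (~` C)).
have hC := isomorphic_variety iC hAC; have hD := isomorphic_variety iD hAD.
have cB : closeds B by exists (~` C); split.
rewrite (class_of_var hA); apply: K0_eq_trans (K0_eq_scissor hC hD cB) _.
by rewrite -!class_of_var; apply: K0_eq_add; apply: class_of_iso.
Qed.

End Isomorphisms.

(** * Polynomial maps and quasi-affine varieties *)

Section Quasiaffine.
Variable k : closedFieldType.

Section RegularOn.
Variables (X : fspace k) (A : set X).

Definition regular_on (f : X -> k) :=
  reg (subspace A) setT (fun x => f (sval x)).

Lemma regular_mul f g :
  regular_on f -> regular_on g -> regular_on (fun x => f x * g x).
Proof. exact/reg_mul/opens_setT. Qed.

Lemma regular_inv f : (forall x, A x -> f x != 0) ->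
  regular_on f -> regular_on (fun x => (f x)^-1).
Proof.
move=> f0 rf; have oT := opens_setT (subspace A).
have := reg_inv oT rf; rewrite setTI; set U := (U in reg _ U _).
suff -> : U = setT by [].
by apply/seteqP; split=> // x _; apply: f0; apply: svalP.
Qed.

Lemma regular_ext f g : (forall x, A x -> f x = g x) ->
  regular_on f -> regular_on g.
Proof. by move=> fg; apply: reg_ext => x _; apply: fg; apply: svalP. Qed.

End RegularOn.

Section PolynomialFunctions.
Variable n : nat.
Implicit Types f g : 'rV[k]_n -> k.

(** Polynomials are treated as functions, so that coordinate changes can be written as explicit
    formulas and checked piece by piece. *)
Definition polynomial f := exists p : {mpoly k[n]}, forall v, peval p v = f v.

Lemma polynomial_peval p : polynomial (peval p).
Proof. by exists p. Qed.

Lemma polynomial_cst c : polynomial (fun=> c).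
Proof. by exists c%:MP => v; rewrite pevalC. Qed.

Lemma polynomial_coord i : polynomial (fun v => v 0 i).
Proof. by exists 'X_i => v; rewrite /peval mevalXU. Qed.

Lemma polynomial_add f g :
  polynomial f -> polynomial g -> polynomial (fun v => f v + g v).
Proof. by move=> [p hp] [q hq]; exists (p + q) => v; rewrite pevalD hp hq. Qed.

Lemma polynomial_mul f g :
  polynomial f -> polynomial g -> polynomial (fun v => f v * g v).
Proof. by move=> [p hp] [q hq]; exists (p * q) => v; rewrite pevalM hp hq. Qed.

Lemma polynomial_opp f : polynomial f -> polynomial (fun v => - f v).
Proof. by move=> [p hp]; exists (- p) => v; rewrite /peval mevalN -hp. Qed.

Lemma polynomial_regular (A : set (affine_space k n)) f :
  polynomial f -> regular_on A f.
Proof.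
move=> [p hp]; have rf : aff_reg [set: 'rV[k]_n] f.
  move=> v _; exists p, 1%:MP; rewrite pevalC oner_neq0; split=> // w _ _.
  by rewrite pevalC divr1 hp.
exact: (@morphism_sval _ _ A).2 (opens_setT (affine_space k n)) rf.
Qed.

End PolynomialFunctions.

Lemma polynomial_comp m n (f : 'rV[k]_n -> k) (h : 'rV[k]_m -> 'rV[k]_n) :
  polynomial f -> (forall i, polynomial (fun v => h v 0 i)) ->
  polynomial (fun v => f (h v)).
Proof.
move=> [p hp] /choice[q hq]; exists (p \mPo [tuple q i | i < n]) => v.
rewrite -hp /peval comp_mpoly_meval; apply: meval_eq => i.
by rewrite tnth_mktuple; apply: hq.
Qed.

Section Coordinates.
Variable n : nat.
Implicit Types (j : 'I_n.+1) (w : 'rV[k]_n) (v : 'rV[k]_n.+1).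

Definition insert_coord j (t : k) w : 'rV[k]_n.+1 :=
  \row_i (if unlift j i is Some i' then w 0 i' else t).

Definition delete_coord j v : 'rV[k]_n := \row_i v 0 (lift j i).

Lemma insert_coord_eq j t w : insert_coord j t w 0 j = t.
Proof. by rewrite mxE unlift_none. Qed.

Lemma insert_coord_lift j t w i : insert_coord j t w 0 (lift j i) = w 0 i.
Proof. by rewrite mxE liftK. Qed.

Lemma insert_coordK j t w : delete_coord j (insert_coord j t w) = w.
Proof. by apply/rowP => i; rewrite mxE insert_coord_lift. Qed.

Lemma delete_coordK j v : insert_coord j (v 0 j) (delete_coord j v) = v.
Proof. by apply/rowP => i; rewrite mxE; case: unliftP => [i'|] ->; rewrite ?mxE. Qed.

Lemma insert_coord_comb j c t t' w w' :
  insert_coord j (t + c * t') (w + c *: w') =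
  insert_coord j t w + c *: insert_coord j t' w'.
Proof. by apply/rowP => i; rewrite !mxE; case: unliftP => [i'|] _; rewrite ?mxE. Qed.

Lemma polynomial_delete j i : polynomial (fun v => delete_coord j v 0 i).
Proof.
have [p hp] := polynomial_coord (lift j i).
by exists p => v; rewrite hp mxE.
Qed.

Lemma polynomial_insert m j (t : 'rV[k]_m -> k) (h : 'rV[k]_m -> 'rV[k]_n) i :
  polynomial t -> (forall l, polynomial (fun u => h u 0 l)) ->
  polynomial (fun u => insert_coord j (t u) (h u) 0 i).
Proof.
case: (unliftP j i) => [i' ->|->] [p hp] Hh.
  by have [q hq] := Hh i'; exists q => u; rewrite hq insert_coord_lift.
by exists p => u; rewrite hp insert_coord_eq.
Qed.

End Coordinates.

Definition quasiaffine n (A : set 'rV[k]_n) : fspace k :=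
  @subspace k (affine_space k n) A.

Lemma isomorphic_quasiaffine n m (A : set 'rV[k]_n) (B : set 'rV[k]_m)
    (f : 'rV[k]_n -> 'rV[k]_m) (g : 'rV[k]_m -> 'rV[k]_n) :
  (forall i, @regular_on (affine_space k n) A (fun v => f v 0 i)) ->
  (forall i, @regular_on (affine_space k m) B (fun v => g v 0 i)) ->
  (forall v, A v -> B (f v)) -> (forall w, B w -> A (g w)) ->
  (forall v, A v -> g (f v) = v) -> (forall w, B w -> f (g w) = w) ->
  isomorphic (quasiaffine A) (quasiaffine B).
Proof.
move=> rf rg fAB gBA fK gK.
exists (fun x : quasiaffine A => exist B (f (sval x)) (fAB _ (svalP x)) : quasiaffine B).
exists (fun y : quasiaffine B => exist A (g (sval y)) (gBA _ (svalP y)) : quasiaffine A).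
split.
- by apply: (@morphism_lift _ _ (affine_space k m)); apply: affine_sub => i; apply: rf.
- by apply: (@morphism_lift _ _ (affine_space k n)); apply: affine_sub => i; apply: rg.
- by move=> x; apply: (@sval_inj _ (affine_space k n)); apply: fK; apply: (svalP x).
- by move=> y; apply: (@sval_inj _ (affine_space k m)); apply: gK; apply: (svalP y).
Qed.

(** A closed set cut by one principal open set. Such sets are stable under intersections and
    polynomial preimages, and they are affine, which fails for general locally closed sets. *)
Definition basic n (A : set 'rV[k]_n) :=
  exists (S : set {mpoly k[n]}) (q : {mpoly k[n]}),
    A = [set v | (forall p, S p -> peval p v = 0) /\ peval q v != 0].

Lemma basic_setT n : basic [set: 'rV[k]_n].
Proof.
exists set0, 1%:MP; apply/seteqP; split=> // v _.
by split=> //; rewrite pevalC oner_neq0.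
Qed.

Lemma basicI n (A B : set 'rV[k]_n) : basic A -> basic B -> basic (A `&` B).
Proof.
move=> [S [q ->]] [S' [q' ->]]; exists (S `|` S'), (q * q').
apply/seteqP; split=> v.
  move=> [[HS hq] [HS' hq']]; split; last by rewrite pevalM mulf_neq0.
  by move=> p [/HS|/HS'].
move=> /= [HS]; rewrite pevalM mulf_eq0 negb_or => /andP[hq hq'].
by split; split=> // p Sp; apply: HS; [left|right].
Qed.

Lemma basic_zero n (f : 'rV[k]_n -> k) : polynomial f -> basic [set v | f v = 0].
Proof.
move=> [p hp]; exists [set p], 1%:MP; apply/seteqP; split=> v /=.
  by move=> fv; rewrite pevalC oner_neq0; split=> // q ->; rewrite hp.
by move=> [/(_ p erefl) + _]; rewrite hp.
Qed.

Lemma basic_neq0 n (f : 'rV[k]_n -> k) : polynomial f -> basic [set v | f v != 0].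
Proof.
move=> [p hp]; exists set0, p; apply/seteqP; split=> v /=; first by rewrite hp.
by move=> [_]; rewrite hp.
Qed.

Lemma basic_forall n (I : Type) (D : set I) (f : I -> 'rV[k]_n -> k) :
  (forall i, polynomial (f i)) -> basic [set v | forall i, D i -> f i v = 0].
Proof.
move=> /choice[p hp]; exists (p @` D), 1%:MP; apply/seteqP; split=> v /=.
  by move=> fv; rewrite pevalC oner_neq0; split=> // _ [i Di <-]; rewrite hp fv.
by move=> [H _] i Di; rewrite -hp H //; exists i.
Qed.

Lemma basic_preimage m n (A : set 'rV[k]_n) (h : 'rV[k]_m -> 'rV[k]_n) :
  basic A -> (forall i, polynomial (fun v => h v 0 i)) -> basic (h @^-1` A).
Proof.
move=> [S [q ->]] hh.
have pol p : polynomial (fun v => peval p (h v)).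
  exact: polynomial_comp (polynomial_peval p) hh.
have := basicI (basic_forall S pol) (basic_neq0 (pol q)).
by congr basic.
Qed.

Lemma closeds_zero n (f : 'rV[k]_n -> k) : polynomial f ->
  @closeds _ (affine_space k n) [set v | f v = 0].
Proof.
move=> [p hp]; exists [set p]; apply/seteqP; split=> v /=.
  by move=> /eqP fv; exists p => //; rewrite hp.
by move=> [_ -> /eqP]; rewrite hp.
Qed.

(** Rabinowitsch trick: the inequality [q != 0] becomes the equation [t * q = 1] in one more
    variable [t], stored as coordinate [0]. *)
Lemma basic_affine n (A : set 'rV[k]_n) : basic A -> is_affine (quasiaffine A).
Proof.
move=> [S [q eA]].
pose d (v : 'rV[k]_n.+1) := delete_coord 0 v.
pose e (v : 'rV[k]_n.+1) := v 0 0 * peval q (d v) - 1.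
have pd p : polynomial (fun v => peval p (d v)).
  by apply: polynomial_comp (polynomial_peval p) _ => i; apply: polynomial_delete.
have pe : polynomial e.
  apply: polynomial_add; last exact: polynomial_cst.
  by apply: polynomial_mul (pd q); apply: polynomial_coord.
(* The equations are described by their values, since [pd] and [pe] only assert that some polynomial
   has these values. *)
exists n.+1, [set r | (exists2 p, S p & forall v, peval r v = peval p (d v)) \/
                      forall v, peval r v = e v].
apply: (@isomorphic_quasiaffine _ _ _ _ (fun v => insert_coord 0 (peval q v)^-1 v) d).
- move=> i; case: (unliftP 0 i) => [i' ->|->].
    apply: (@regular_ext (affine_space k n) _ (fun v => v 0 i')).
      by move=> v _; rewrite insert_coord_lift.
    exact/polynomial_regular/polynomial_coord.
  apply: (@regular_ext (affine_space k n) _ (fun v => (peval q v)^-1)).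
    by move=> v _; rewrite insert_coord_eq.
  apply: (@regular_inv (affine_space k n)); first by rewrite eA => v [].
  exact/polynomial_regular/polynomial_peval.
- by move=> i; apply/polynomial_regular/polynomial_delete.
- rewrite eA => v [HS qv] r /= [[p Sp ->]|->]; first by rewrite /d insert_coordK HS.
  by rewrite /e /d insert_coordK insert_coord_eq mulVf ?subrr.
- rewrite eA => v Hv; have ev : e v = 0.
    by have [r hr] := pe; rewrite -hr; apply: Hv; right.
  split.
    by move=> p Sp; have [r hr] := pd p; rewrite -hr; apply: Hv; left; exists p.
  by apply: contra_eq_neq ev => qv; rewrite /e qv mulr0 sub0r oppr_eq0 oner_neq0.
- by move=> v _; rewrite /d insert_coordK.
- move=> v Hv; have ev : e v = 0.
    by have [r hr] := pe; rewrite -hr; apply: Hv; right.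
  rewrite -[RHS](delete_coordK 0); congr insert_coord.
  have e1 : v 0 0 * peval q (d v) = 1 by apply: subr0_eq.
  rewrite -[LHS]mul1r -e1 mulfK //.
  by apply: contra_eq_neq e1 => ->; rewrite mulr0 eq_sym oner_neq0.
Qed.

Lemma basic_variety n (A : set 'rV[k]_n) : basic A -> is_variety (quasiaffine A).
Proof.
move=> bA; apply: (@affine_variety _ _ n (fun x : quasiaffine A => sval x)).
- exact: morphism_sval.
- exact: sval_inj.
- exact: basic_affine.
Qed.

End Quasiaffine.

(** * Classes of quasi-affine sets and congruence modulo [L] *)

Section Classes.
Variable k : closedFieldType.
Let L := lefschetz k.

Add Ring K0_ring : (K0_ring k)
  (setoid (K0_eq_equiv k) (K0_ring_ext k)).

#[export] Instance K0_add_proper : Proper (@K0_eq k ==> @K0_eq k ==> @K0_eq k) (@K0_add k).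
Proof. by move=> a a' ha b b' hb; apply: K0_eq_add. Qed.

#[export] Instance K0_mul_proper : Proper (@K0_eq k ==> @K0_eq k ==> @K0_eq k) (@K0_mul k).
Proof. by move=> a a' ha b b' hb; apply: K0_eq_mul. Qed.

#[export] Instance K0_opp_proper : Proper (@K0_eq k ==> @K0_eq k) (@K0_opp k).
Proof. exact: K0_eq_opp. Qed.

#[export] Instance K0_sub_proper : Proper (@K0_eq k ==> @K0_eq k ==> @K0_eq k) (@K0_sub k).
Proof. by move=> a a' ha b b' hb; apply: K0_eq_add (K0_eq_opp hb). Qed.

Definition eq_modL (a b : K0 k) := exists c, K0_eq a (K0_add b (K0_mul c L)).

Definition qclass n (A : set 'rV[k]_n) : K0 k := class_of (quasiaffine A).

Lemma qclass_split n (A : set 'rV[k]_n) (f : 'rV[k]_n -> k) :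
  basic A -> polynomial f ->
  K0_eq (qclass A) (K0_add (qclass (A `&` [set v | f v = 0]))
                           (qclass (A `&` [set v | f v != 0]))).
Proof.
move=> bA pf.
have -> : A `&` [set v | f v != 0] = A `\` [set v | f v = 0].
  by apply/seteqP; split=> v [Av /eqP].
apply: (@class_of_scissor _ (affine_space k n)); first exact: closeds_zero.
- exact: basic_variety.
- by apply: basic_variety; apply: basicI => //; apply: basic_zero.
- have -> : A `\` [set v | f v = 0] = A `&` [set v | f v != 0].
    by apply/seteqP; split=> v [Av /eqP].
  by apply: basic_variety; apply: basicI => //; apply: basic_neq0.
Qed.

(** Cutting the empty set along any zero locus gives [a = a + a] for its class [a], hence
    [a = 0]. *)
Lemma qclass_set0 n : K0_eq (qclass (set0 : set 'rV[k]_n)) K0_zero.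
Proof.
have b0 : basic (set0 : set 'rV[k]_n).
  have := basicI (basic_zero (polynomial_cst n (1 : k))) (basic_setT k n).
  by congr basic; apply/seteqP; split=> v // [/eqP]; rewrite oner_eq0.
have := qclass_split b0 (polynomial_cst n 0); rewrite !set0I => H.
transitivity (K0_sub (K0_add (qclass (set0 : set 'rV[k]_n)) (qclass (set0 : set 'rV[k]_n)))
                (qclass (set0 : set 'rV[k]_n))); first by ring.
by rewrite -H; ring.
Qed.

Lemma qclass_point n : K0_eq (qclass [set 0 : 'rV[k]_n]) K0_one.
Proof.
symmetry; rewrite K0_eq_point -class_of_var; apply: class_of_iso.
apply: (isomorphic_trans (isomorphic_sym (@isomorphic_setT _ (affine_space k 0)))).
apply: (@isomorphic_quasiaffine _ 0 n setT [set 0] (fun=> 0) (fun=> 0)) => //.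
- by move=> i; apply/polynomial_regular; have [p hp] := polynomial_cst 0 (0 : k);
     exists p => v; rewrite hp mxE.
- by case.
- by move=> v _; apply/rowP => -[].
Qed.

(** The preimage is the product of the affine line, seen by coordinate [0], with [A], seen by the
    remaining coordinates. The universal property is checked directly. *)
Lemma qclass_line n (A : set 'rV[k]_n) : basic A ->
  K0_eq (qclass (delete_coord 0 @^-1` A)) (K0_mul L (qclass A)).
Proof.
move=> bA; set B := _ @^-1` _.
have bB : basic B by apply: basic_preimage bA _ => i; apply: polynomial_delete.
have hA := basic_variety bA; have hB := basic_variety bB.
rewrite /qclass (class_of_var hA) (class_of_var hB) /L /lefschetz; symmetry.
pose p (z : quasiaffine B) : affine_space k 1 := const_mx (sval z 0 0).
pose q (z : quasiaffine B) : quasiaffine A :=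
  exist A (delete_coord 0 (sval z)) (svalP z).
apply: (@K0_eq_prod _ (Variety (affine_space_variety k 1)) (Variety hA) (Variety hB) p q); split; [|split].
- apply: affine_sub => i.
  have rc : @regular_on _ (affine_space k n.+1) B (fun v : 'rV[k]_n.+1 => v 0 0).
    exact/polynomial_regular/polynomial_coord.
  by apply: reg_ext rc => z _; rewrite /= mxE.
- apply: (@morphism_lift _ _ (affine_space k n)); apply: affine_sub => i.
  exact: (@polynomial_regular _ _ B _ (@polynomial_delete k n 0 i)).
move=> T vT f g mf mg.
have hh t : B (insert_coord 0 ((f t : 'rV[k]_1) 0 0) (sval (g t))).
  by rewrite /B /= insert_coordK; apply: (svalP (g t)).
(* The two projections determine all coordinates, so this is the only possible map: coordinate [0]
   from [f], the others from [g]. *)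
exists (fun t => exist B _ (hh t)); split.
  split.
  - apply: (@morphism_lift _ _ (affine_space k n.+1)); apply: affine_sub => i.
    have oT := opens_setT T.
    case: (unliftP 0 i) => [i' ->|->].
      have [m1 m2] := morphism_comp mg (@morphism_sval _ (affine_space k n) A).
      apply: reg_ext (m2 _ _ (opens_setT _) (@reg_coord k n i')) => t _ /=.
      by rewrite insert_coord_lift.
    apply: reg_ext (mf.2 _ _ (opens_setT _) (@reg_coord k 1 0)) => t _ /=.
    by rewrite insert_coord_eq.
  - apply: funext => t; rewrite /p /=; apply/rowP => i.
    by rewrite mxE insert_coord_eq ord1.
  - apply: funext => t; apply: (@sval_inj _ (affine_space k n)).
    by rewrite /= insert_coordK.
move=> h [mh ph qh]; apply: funext => t; apply: (@sval_inj _ (affine_space k n.+1)).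
by rewrite /= -ph -qh /= /p mxE delete_coordK.
Qed.

Lemma K0_eq_modL a b : K0_eq a b -> eq_modL a b.
Proof. by move=> eab; exists K0_zero; rewrite eab; ring. Qed.

#[export] Instance eq_modL_equiv : Equivalence eq_modL.
Proof.
split.
- by move=> a; apply: K0_eq_modL; reflexivity.
- by move=> a b [c eab]; exists (K0_opp c); rewrite eab; ring.
- by move=> a b c [x eab] [y ebc]; exists (K0_add x y); rewrite eab ebc; ring.
Qed.

#[export] Instance K0_eq_modL_sub : subrelation (@K0_eq k) eq_modL.
Proof. exact: K0_eq_modL. Qed.

#[export] Instance modL_add_proper :
  Proper (eq_modL ==> eq_modL ==> eq_modL) (@K0_add k).
Proof.
move=> a a' [x ea] b b' [y eb]; exists (K0_add x y); rewrite ea eb; ring.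
Qed.

#[export] Instance modL_opp_proper : Proper (eq_modL ==> eq_modL) (@K0_opp k).
Proof. by move=> a a' [x ea]; exists (K0_opp x); rewrite ea; ring. Qed.

Lemma modL_mulL a : eq_modL (K0_mul L a) K0_zero.
Proof. by exists a; ring. Qed.

(** An affine space of positive dimension is a line times a smaller one. In dimension [0] the class
    would be [1]. *)
Lemma qclass_space n : eq_modL (qclass [set: 'rV[k]_n.+1]) K0_zero.
Proof.
have := qclass_line (basic_setT k n); rewrite preimage_setT => ->.
exact: modL_mulL.
Qed.

(** The shape of one descent step: [a] is the class of a zero set and [b] that of the zero set of
    its slope, of lower degree. *)
Lemma modL_opp_zero a b :
  eq_modL a (K0_opp b) -> eq_modL b K0_zero -> eq_modL a K0_zero.
Proof. by move=> -> ->; apply: K0_eq_modL; ring. Qed.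

Lemma L_rational_class (X : variety k) :
  eq_modL (class_of X) K0_one -> L_rational X.
Proof.
rewrite class_ofE => -[c hc]; exists c; rewrite /K0_sub hc -/L; ring.
Qed.

End Classes.

(** * Zero sets of functions that are affine along one direction *)

Section Projection.
Variable k : closedFieldType.

Add Ring K0_ring : (K0_ring k)
  (setoid (K0_eq_equiv k) (K0_ring_ext k)).

Lemma qclass_iso n m (A : set 'rV[k]_n) (B : set 'rV[k]_m) :
  isomorphic (quasiaffine A) (quasiaffine B) -> K0_eq (qclass A) (qclass B).
Proof. exact: class_of_iso. Qed.

(** [insert_coord j 0] parametrizes the hyperplane [v_j = 0], which serves as the complement [W] of
    the line [k p] when [p_j != 0]. *)
Lemma polynomial_insert0 n (j : 'I_n.+1) (f : 'rV[k]_n.+1 -> k) :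
  polynomial f -> polynomial (fun w => f (insert_coord j 0 w)).
Proof.
move=> pf; apply: polynomial_comp pf _ => i.
by apply: polynomial_insert; [apply: polynomial_cst|apply: polynomial_coord].
Qed.

(** Taking [t = 1], the slope is [f (v + p) - f v]. *)
Lemma polynomial_slope n (f g : 'rV[k]_n -> k) p : polynomial f ->
  (forall v t, f (v + t *: p) = f v + t * g v) -> polynomial g.
Proof.
move=> pf fg; have [r hr] : polynomial (fun v => f (v + p) + - f v).
  apply: polynomial_add; last exact: polynomial_opp.
  apply: polynomial_comp pf _ => i.
  have [r hr] := polynomial_add (polynomial_coord k i) (polynomial_cst _ (p 0 i)).
  by exists r => v; rewrite hr mxE.
by exists r => v; rewrite hr -[p]scale1r fg mul1r addrAC addrN add0r.
Qed.

(* Along the direction [p] the equation [f] is affine with slope [g]: over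
   [g != 0] it has one solution, over [f = g = 0] a line of solutions. *)
Lemma qclass_zeros_affine n (f g : 'rV[k]_n.+2 -> k) (p : 'rV[k]_n.+2) j :
  polynomial f -> p 0 j != 0 ->
  (forall v t, f (v + t *: p) = f v + t * g v) ->
  eq_modL (qclass [set v | f v = 0])
    (K0_opp (qclass [set w | g (insert_coord j 0 w) = 0])).
Proof.
move=> pf pj fg.
pose F w := f (insert_coord j 0 w); pose G w := g (insert_coord j 0 w).
pose d (u : 'rV[k]_n.+2) := delete_coord 0 u.
have pF : polynomial F by apply: polynomial_insert0.
have pG : polynomial G by apply/polynomial_insert0/(polynomial_slope pf fg).
have pd h : polynomial h -> polynomial (fun u => h (d u)).
  by move=> ph; apply: polynomial_comp ph _ => i; apply: polynomial_delete.
(* [Z] is the zero set of [f] in the coordinates [(t, w)] of the decomposition [v = w + t p], with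
   [t] stored as coordinate [0]. *)
pose Z := [set u | F (d u) + u 0 0 * G (d u) = 0].
have bZ : basic Z.
  apply/basic_zero/polynomial_add; first exact: pd.
  by apply: polynomial_mul (pd _ pG); apply: polynomial_coord.
have eZ : K0_eq (qclass [set v | f v = 0]) (qclass Z).
  apply: qclass_iso.
  (* The coefficient of [p]: it is the scalar for which [v - t p] has coordinate [j] equal to [0]
     and so lies in [W]. *)
  pose t (v : 'rV[k]_n.+2) := v 0 j / p 0 j.
  have pt : polynomial t.
    by apply: polynomial_mul; [apply: polynomial_coord|apply: polynomial_cst].
  pose a v := insert_coord 0 (t v) (delete_coord j (v - t v *: p)).
  pose b u := insert_coord j 0 (d u) + u 0 0 *: p.
  have aK v : b (a v) = v.
    rewrite /b /a /d insert_coordK insert_coord_eq.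
    have vj : (v - t v *: p) 0 j = 0 by rewrite !mxE divfK // subrr.
    by rewrite -[X in insert_coord j X]vj delete_coordK subrK.
  have bj u : t (b u) = u 0 0.
    by rewrite /t /b !mxE unlift_none add0r mulfK.
  have bK u : a (b u) = u.
    by rewrite /a bj /b addrK insert_coordK delete_coordK.
  have fb u : f (b u) = F (d u) + u 0 0 * G (d u) by rewrite /b fg.
  apply: (isomorphic_quasiaffine (f := a) (g := b)) => //.
  - move=> i; apply/polynomial_regular/polynomial_insert => // l.
    have pl := polynomial_coord k (lift j l).
    have [r hr] := polynomial_add pl (polynomial_opp
      (polynomial_mul pt (polynomial_cst _ (p 0 (lift j l))))).
    by exists r => v; rewrite hr !mxE.
  - move=> i; apply/polynomial_regular.
    have [r hr] : polynomial (fun u => insert_coord j 0 (d u) 0 i + u 0 0 * p 0 i).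
      apply: polynomial_add.
        apply: polynomial_insert; first exact: polynomial_cst.
        by move=> l; apply: polynomial_delete.
      by apply: polynomial_mul; [apply: polynomial_coord|apply: polynomial_cst].
    by exists r => u; rewrite hr [RHS]mxE [X in _ = _ + X]mxE.
  - by move=> v fv; rewrite /Z /= -fb aK.
  - by move=> u; rewrite /Z /= fb.
have bFG : basic [set w | F w = 0 /\ G w = 0].
  exact: basicI (basic_zero pF) (basic_zero pG).
(* Where [G] vanishes, the equation of [Z] no longer involves [t], and [t] is a free line
   coordinate. *)
have eZ0 : K0_eq (qclass (Z `&` [set u | G (d u) = 0]))
    (K0_mul (lefschetz k) (qclass [set w | F w = 0 /\ G w = 0])).
  suff -> : Z `&` [set u | G (d u) = 0] = d @^-1` [set w | F w = 0 /\ G w = 0].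
    exact: qclass_line.
  apply/seteqP; split=> u; rewrite /Z /preimage /=.
    by move=> [Zu Gu]; rewrite Gu mulr0 addr0 in Zu.
  by move=> [-> ->]; rewrite mulr0 addr0.
have eZ1 : K0_eq (qclass (Z `&` [set u | G (d u) != 0])) (qclass [set w | G w != 0]).
  apply: qclass_iso.
  apply: (isomorphic_quasiaffine (f := d) (g := fun w => insert_coord 0 (- F w / G w) w)).
  - by move=> i; apply/polynomial_regular/polynomial_delete.
  - move=> i; case: (unliftP 0 i) => [i' ->|->].
      apply: (@regular_ext _ (affine_space k _) _ (fun w => w 0 i')).
        by move=> w _; rewrite insert_coord_lift.
      exact/polynomial_regular/polynomial_coord.
    apply: (@regular_ext _ (affine_space k _) _ (fun w => - F w / G w)).
      by move=> w _; rewrite insert_coord_eq.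
    apply: (@regular_mul _ (affine_space k _)).
      exact/polynomial_regular/polynomial_opp.
    by apply: (@regular_inv _ (affine_space k _)) => //; apply/polynomial_regular.
  - by move=> u [].
  - move=> w /= Gw; rewrite /Z /d /= insert_coordK insert_coord_eq; split=> //.
    by rewrite divfK // addrN.
  - move=> u [Zu /= Gu]; rewrite -[RHS](delete_coordK 0); congr insert_coord.
    have -> : F (d u) = - (u 0 0 * G (d u)) by apply/eqP; rewrite -addr_eq0; apply/eqP.
    by rewrite opprK mulfK.
  - by move=> w _; rewrite /d insert_coordK.
have := qclass_split bZ (pd _ pG); rewrite eZ0 eZ1 => eZ2.
pose Gz := qclass [set w | G w = 0]; pose Gn := qclass [set w | G w != 0].
have eT : K0_eq (qclass [set: 'rV[k]_n.+1]) (K0_add Gz Gn).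
  by have := qclass_split (basic_setT k n.+1) pG; rewrite !setTI.
have -> : eq_modL (qclass [set v | f v = 0]) Gn.
  by rewrite eZ eZ2 modL_mulL -/Gn; apply: K0_eq_modL; ring.
(* The locus [G != 0] is [[W] - [G = 0]], and [[W]] is divisible by [L] because [W] has [n + 1 > 0]
   coordinates. *)
transitivity (K0_add (qclass [set: 'rV[k]_n.+1]) (K0_opp Gz)).
  by rewrite eT; apply: K0_eq_modL; ring.
by rewrite qclass_space -/Gz; apply: K0_eq_modL; ring.
Qed.

End Projection.

(** * Charts of closed subsets of projective space *)

Section ProjectiveCone.
Variable k : closedFieldType.

Section ProjectiveZeros.
Variables (n : nat) (S : set {mpoly k[n.+1]}).
Hypothesis hS : forall p, S p -> exists d, p \is d.-homog.

Definition proj_zeros : set (proj_space k n) :=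
  [set x | forall p, S p -> heval p x = 0].

(** The dehomogenization: each line with nonzero coordinate [i] has exactly one spanning vector with
    that coordinate [1]. *)
Definition chart_zeros i : set 'rV[k]_n.+1 :=
  [set v : 'rV[k]_n.+1 | v 0 i = 1 /\ forall p, S p -> peval p v = 0].

Lemma basic_chart_zeros i : basic (chart_zeros i).
Proof.
have pi : polynomial (fun v : 'rV[k]_n.+1 => v 0 i + - 1).
  by apply: polynomial_add; [apply: polynomial_coord|apply: polynomial_cst].
have := basicI (basic_zero pi) (basic_forall S (@polynomial_peval k n.+1)).
congr basic; apply/seteqP; split=> v [vi Hv]; split=> //.
  exact: subr0_eq.
by rewrite /= vi subrr.
Qed.

Lemma isomorphic_chart i :
  isomorphic (subspace (proj_zeros `&` @chart k n i))
    (quasiaffine (chart_zeros i)).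
Proof.
set A := chart_zeros i; set B := proj_zeros `&` _.
have A0 (v : 'rV[k]_n.+1) : A v -> v != 0.
  by move=> [vi _]; apply: contra_eq_neq vi => ->; rewrite mxE eq_sym oner_neq0.
(* Dividing by coordinate [i] removes the dependence on the chosen vector [hcoord]; the resulting
   entries are the regular functions of [reg_ratio]. *)
pose v (x : subspace B) : 'rV[k]_n.+1 :=
  (hcoord (sval x) 0 i)^-1 *: hcoord (sval x).
have vA x : A (v x).
  have [Hx xi] := svalP x; split; first by rewrite mxE mulVf.
  by move=> p Sp; have [d hp] := hS Sp; rewrite (peval_scale _ _ hp) [peval _ _]Hx ?mulr0.
pose x (w : quasiaffine A) : proj_space k n := line_of A0 w.
have xB w : B (x w).
  have [wi Hw] := svalP w; split.
    move=> p Sp; have [d hp] := hS Sp.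
    have [c c0] := heval_line_of A0 w hp; rewrite (Hw _ Sp) => /esym/eqP.
    by rewrite mulf_eq0 expf_eq0 (negPf c0) andbF => /eqP.
  have [c c0 ec] := hcoord_line A0 w; move: wi; rewrite ec mxE => /eqP.
  by rewrite /chart /=; apply: contraTneq => ->; rewrite mulr0 eq_sym oner_neq0.
exists (fun y => exist A (v y) (vA y)).
exists (fun w => exist _ (x w) (xB w)); split.
- apply: (@morphism_lift _ _ (affine_space k n.+1)); apply: affine_sub => j.
  have [m1 m2] := @morphism_sval _ (proj_space k n) B.
  have sU : [set: subspace B] `<=` sval @^-1` chart i by move=> y _; case: (svalP y).
  have r := reg_sub (m1 _ (@opens_chart k n i)) (opens_setT _) sU
    (m2 _ _ (@opens_chart k n i) (@reg_ratio k n i j)).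
  by apply: reg_ext r => y _; rewrite /= mxE mulrC.
- by apply: morphism_lift; apply: morphism_line.
- move=> y; apply: sval_inj => /=; apply: val_inj => /=.
  rewrite line_hcoord; apply/eqP.
  have yi : hcoord (sval y) 0 i != 0 := (svalP y).2.
  rewrite eqEdim !dim_vline scaler_eq0 invr_eq0 (negPf yi) !hcoord_neq0 leqnn.
  by rewrite andbT -memvE memvZ ?memv_line.
- move=> w; apply: (@sval_inj _ (affine_space k n.+1)) => /=.
  have [c c0 ec] := hcoord_line A0 w; rewrite /v /= -/(x w).
  have [e1 _] := svalP w; move: e1; rewrite ec -/(x w) mxE => e1.
  congr (_ *: _); have x0 := (xB w).2; rewrite /= /chart /= in x0.
  by apply: (mulIf x0); rewrite mulVf // e1.
Qed.

Lemma proj_zeros_variety : is_variety (subspace proj_zeros).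
Proof.
split; last first.
  exact: separated_inj (@morphism_sval _ _ _) (@sval_inj _ _ _)
    (@proj_space_separated k n).
exists n.+1, (fun i => [set x : subspace proj_zeros | chart i (sval x)]).
split; last by move=> x; apply: chart_cover.
move=> i; split; first by exists (chart i); split=> //; apply: opens_chart.
apply: isomorphic_affine (basic_affine (basic_chart_zeros i)).
exact: isomorphic_trans (isomorphic_subsub _ _) (isomorphic_chart i).
Qed.

Lemma proj_zeros_chart_variety i : is_variety (subspace (proj_zeros `&` @chart k n i)).
Proof.
exact: isomorphic_variety (isomorphic_chart i) (basic_variety (basic_chart_zeros i)).
Qed.

End ProjectiveZeros.

End ProjectiveCone.

(** * The class of a projective hypersurface against that of its affine cone *)

Section Cone.
Variable k : closedFieldType.

Add Ring K0_ring : (K0_ring k)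
  (setoid (K0_eq_equiv k) (K0_ring_ext k)).

Variables (n d : nat) (F : {mpoly k[n.+1]}).
Hypotheses (hF : F \is d.-homog) (d_gt0 : (0 < d)%N).

(** These equations cut the hypersurface by the coordinate flag [x_0 = ... = x_(m-1) = 0]. Between
    the stages [i] and [i + 1] lies the part where [x_i] is the first nonzero coordinate. *)
Definition flag_eqs (m : nat) : set {mpoly k[n.+1]} :=
  [set q | q = F \/ exists2 j : 'I_n.+1, (j < m)%N & q = 'X_j].

Definition flag_proj m := proj_zeros (flag_eqs m).

Definition flag_cone m : set 'rV[k]_n.+1 :=
  [set v | forall q, flag_eqs m q -> peval q v = 0].

Lemma flag_eqs_homog m q : flag_eqs m q -> exists e, q \is e.-homog.
Proof.
by move=> [->|[j _ ->]]; [exists d|exists 1%N; apply: dhomogXi].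
Qed.

Lemma flag_coneP m v : flag_cone m v <->
  peval F v = 0 /\ forall j : 'I_n.+1, (j < m)%N -> v 0 j = 0.
Proof.
split=> [H|[Fv H] q [->//|[j jm ->]]]; last by rewrite /peval mevalXU H.
split=> [|j jm]; first by apply: H; left.
by rewrite -(H 'X_j) ?/peval ?mevalXU //; right; exists j.
Qed.

Lemma flag_projP m x : flag_proj m x <->
  heval F x = 0 /\ forall j : 'I_n.+1, (j < m)%N -> hcoord x 0 j = 0.
Proof. exact: flag_coneP. Qed.

Lemma flag_coneS (i : 'I_n.+1) v :
  flag_cone i.+1 v <-> flag_cone i v /\ v 0 i = 0.
Proof.
rewrite !flag_coneP; split=> [[Fv H]|[[Fv H] vi]].
  by split; [split=> // j ji; apply/H/ltnW|apply: H].
split=> // j; rewrite ltnS leq_eqVlt => /orP[/eqP/val_inj->//|]; exact: H.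
Qed.

Lemma flag_cone_scale m c v : flag_cone m v -> flag_cone m (c *: v).
Proof.
move=> Hv q Sq; have [e hq] := flag_eqs_homog Sq.
by rewrite (peval_scale _ _ hq) Hv ?mulr0.
Qed.

Lemma basic_flag_cone m : basic (flag_cone m).
Proof. exact: basic_forall (@polynomial_peval k n.+1). Qed.

(** The part of the cone lying over the chart [x_i != 0] is a product with the
    punctured line. *)
Lemma qclass_cone_chart (i : 'I_n.+1) :
  K0_eq (qclass (flag_cone i `&` [set v | v 0 i != 0]))
    (K0_sub (K0_mul (lefschetz k) (qclass (chart_zeros (flag_eqs i) i)))
            (qclass (chart_zeros (flag_eqs i) i))).
Proof.
set A := chart_zeros _ _; have bA : basic A by apply: basic_chart_zeros.
pose B : set 'rV[k]_n.+2 := delete_coord 0 @^-1` A.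
have bB : basic B by apply: basic_preimage bA _ => l; apply: polynomial_delete.
have p0 := polynomial_coord k (0 : 'I_n.+2).
have e0 : K0_eq (qclass (B `&` [set u | u 0 0 = 0])) (qclass A).
  apply/qclass_iso/(isomorphic_quasiaffine (f := delete_coord 0)
    (g := insert_coord 0 0)).
  - by move=> l; apply/polynomial_regular/polynomial_delete.
  - move=> l; apply/polynomial_regular/polynomial_insert.
      exact: polynomial_cst.
    exact: polynomial_coord.
  - by move=> u [].
  - by move=> w Aw; split; rewrite /B /= ?insert_coordK ?insert_coord_eq.
  - by move=> u [_ /= u0]; rewrite -[X in insert_coord 0 X]u0 delete_coordK.
  - by move=> w _; rewrite insert_coordK.
(* For [t != 0] the map [(t, w) -> t w] is invertible: since [w_i = 1], the scalar [t] is read off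
   as [v_i]. *)
have e1 : K0_eq (qclass (B `&` [set u | u 0 0 != 0]))
                (qclass (flag_cone i `&` [set v | v 0 i != 0])).
  apply/qclass_iso/(isomorphic_quasiaffine (f := fun u => u 0 0 *: delete_coord 0 u)
    (g := fun v => insert_coord 0 (v 0 i) ((v 0 i)^-1 *: v))).
  - move=> l; apply/polynomial_regular.
    have [r hr] := polynomial_mul p0 (@polynomial_delete k n.+1 0 l).
    by exists r => u; rewrite hr [RHS]mxE.
  - move=> l; have pi := polynomial_coord k i.
    case: (unliftP 0 l) => [l' ->|->].
      apply: (@regular_ext _ (affine_space k _) _ (fun v => (v 0 i)^-1 * v 0 l')).
        by move=> v _; rewrite insert_coord_lift mxE.
      apply: (@regular_mul _ (affine_space k _)).
        apply: (@regular_inv _ (affine_space k _)) => [v []//|].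
        exact: polynomial_regular.
      exact/polynomial_regular/polynomial_coord.
    apply: (@regular_ext _ (affine_space k _) _ (fun v => v 0 i)).
      by move=> v _; rewrite insert_coord_eq.
    exact: polynomial_regular.
  - move=> u [[ui Hu] /= u0]; split; first exact: flag_cone_scale.
    by rewrite /= mxE ui mulr1.
  - move=> v [Hv /= vi]; split; rewrite /B /A /= ?insert_coord_eq //.
    rewrite insert_coordK; split; first by rewrite mxE mulVf.
    exact: flag_cone_scale.
  - move=> u [[ui Hu] /= u0]; rewrite mxE ui mulr1 scalerA mulVf // scale1r.
    exact: delete_coordK.
  - by move=> v [_ /= vi]; rewrite insert_coord_eq insert_coordK scalerA mulfV ?scale1r.
have := qclass_split bB p0; rewrite e0 e1 (qclass_line bA) => ->; ring.
Qed.

(** Scissor relation for the closed complement [x_i = 0] of the chart, which cuts stage [i] of the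
    flag down to stage [i + 1]. *)
Lemma class_proj_chart (i : 'I_n.+1) :
  K0_eq (class_of (subspace (flag_proj i)))
    (K0_add (class_of (subspace (flag_proj i.+1)))
            (qclass (chart_zeros (flag_eqs i) i))).
Proof.
pose C : set (proj_space k n) := ~` @chart k n i.
have cC : closeds C by rewrite /closeds setCK; apply: opens_chart.
have eC : flag_proj i `&` C = flag_proj i.+1.
  apply/seteqP; split=> x.
    move=> [Hx /negP/negPn/eqP xi].
    exact: (iffRL (flag_coneS i (hcoord x))).
  move=> /(iffLR (flag_coneS i (hcoord x)))[Hx xi]; split=> //; rewrite /C /chart /= xi eqxx //.
have eD : flag_proj i `\` C = flag_proj i `&` @chart k n i.
  by rewrite setDE setCK.
have := class_of_scissor cC; move/(_ (flag_proj i)); rewrite eC eD.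
move=> ->; try (by apply: proj_zeros_variety; apply: flag_eqs_homog).
  by rewrite (class_of_iso (isomorphic_chart (@flag_eqs_homog i) i)); reflexivity.
exact: proj_zeros_chart_variety (@flag_eqs_homog i) i.
Qed.

(** Descending induction along the flag. With [T] the class of the chart piece, passing from [m + 1]
    to [m] adds [T] to the projective part and [L T - T] to the cone, so the sum changes by [L T].
    At [m = n + 1] the projective part is empty and the cone is the origin, of class [1]. *)
Lemma class_proj_cone m : (m <= n.+1)%N ->
  eq_modL (K0_add (class_of (subspace (flag_proj m))) (qclass (flag_cone m))) K0_one.
Proof.
(* Writing [m] as [n + 1 - e] turns the descent into an induction on [e]. *)
move=> hm; rewrite -(subKn hm); elim: (n.+1 - m)%N (leq_subr m n.+1) => [|e IH] he.
  have full (v : 'rV[k]_n.+1) :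
      (forall j : 'I_n.+1, (j < n.+1 - 0)%N -> v 0 j = 0) -> v = 0.
    by move=> H; apply/rowP => j; rewrite mxE H // subn0.
  have -> : flag_cone (n.+1 - 0) = [set 0].
    apply/seteqP; split=> v; first by move/flag_coneP => [_ /full].
    move=> ->; apply/flag_coneP; split; last by move=> j _; rewrite mxE.
    (* The origin lies on the cone because [F] scales by [0 ^ d], which is [0] for [d > 0]. *)
    rewrite -(scale0r 0) (peval_scale _ _ hF) expr0n eqn0Ngt d_gt0 mul0r //.
  have e0 : flag_proj (n.+1 - 0) = set0.
    apply/seteqP; split=> // x /flag_projP[_ /full].
    by apply/eqP; apply: hcoord_neq0.
  (* The empty projective set coincides with its chart [0], hence is isomorphic to an empty
     quasi-affine set, whose class is known. *)
  have e1 : K0_eq (class_of (subspace (flag_proj (n.+1 - 0)))) (K0_zero).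
    rewrite -(qclass_set0 k n.+1).
    have hS := @flag_eqs_homog (n.+1 - 0).
    have := class_of_iso (isomorphic_chart hS 0).
    rewrite -/(flag_proj _) e0 set0I => ->.
    suff -> : chart_zeros (flag_eqs (n.+1 - 0)) 0 = set0 by reflexivity.
    apply/seteqP; split=> // v [v0 /flag_coneP[_ /full v00]].
    by move: v0; rewrite v00 mxE => /eqP; rewrite eq_sym oner_eq0.
  by rewrite e1 qclass_point; apply: K0_eq_modL; ring.
have hi : (n.+1 - e.+1 < n.+1)%N by rewrite subSS ltnS leq_subr.
have ee : (n.+1 - e = (n.+1 - e.+1).+1)%N by rewrite -(subSn he) subSS.
have := IH (ltnW he); rewrite ee => <-.
pose i := Ordinal hi; set T := qclass (chart_zeros (flag_eqs i) i).
have eP : K0_eq (class_of (subspace (flag_proj (n.+1 - e.+1))))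
   (K0_add (class_of (subspace (flag_proj (n.+1 - e.+1).+1))) T).
  exact: (class_proj_chart i).
have := qclass_split (basic_flag_cone i) (polynomial_coord k i).
have -> : flag_cone i `&` [set v | v 0 i = 0] = flag_cone (n.+1 - e.+1).+1.
  by apply/seteqP; split=> v /(flag_coneS i).
rewrite (qclass_cone_chart i) -/T /= => eC; rewrite eP eC.
transitivity (K0_add (K0_add (class_of (subspace (flag_proj (n.+1 - e.+1).+1)))
  (qclass (flag_cone (n.+1 - e.+1).+1))) (K0_mul (lefschetz k) T)).
  by apply: K0_eq_modL; ring.
by rewrite modL_mulL; apply: K0_eq_modL; ring.
Qed.

(** At stage [0] of the flag no coordinate is constrained, so [class_proj_cone] relates [X] and its
    full cone. *)
Lemma L_rational_cone :
  eq_modL (qclass [set v | peval F v = 0]) K0_zero -> L_rational (hypersurface hF).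
Proof.
move=> H; apply: L_rational_class.
rewrite [class_of _]/(class_of (@subspace k (proj_space k n) _)).
have <- : flag_proj 0 = [set x | heval F x = 0].
  by apply/seteqP; split=> x; [case/flag_projP|move=> Fx; apply/flag_projP].
have := class_proj_cone (leq0n n.+1).
have -> : flag_cone 0 = [set v | peval F v = 0].
  by apply/seteqP; split=> v; [case/flag_coneP|move=> Fv; apply/flag_coneP].
rewrite H => <-; set X := class_of _.
have eX : K0_eq X (K0_add X K0_zero) by ring.
exact: K0_eq_modL eX.
Qed.

End Cone.

From mathcomp Require Import ring.

(** * Multilinear expansions of forms and descent on the degree *)

Section Forms.
Variable k : closedFieldType.

(** Every monomial of positive degree contains some variable, which is factored out. Iterating this
    gives multilinear forms without polarization, hence without symmetry and without dividing by
    factorials. *)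
Lemma dhomog_split n d (p : {mpoly k[n]}) : p \is d.+1.-homog ->
  exists2 q : 'I_n -> {mpoly k[n]},
    forall i, q i \is d.-homog & p = \sum_i 'X_i * q i.
Proof.
move=> /dhomogP hp; rewrite [p]mpolyE big_seq.
elim/big_rec: _ => [|m x /hp hm [q hq ->]].
  exists (fun=> 0) => [i|]; first exact: rpred0.
  by rewrite big1 // => i _; rewrite mulr0.
have [i mi] : exists i, m i != 0%N.
  apply/existsP; apply: contra_eqT hm => /existsPn m0.
  by rewrite /= mdegE big1 // => i _; apply/eqP; have := m0 i; rewrite negbK.
have le_im : (U_(i) <= m)%MM.
  by apply/mnm_lepP => j; rewrite mnm1E; case: eqP => // <-; rewrite lt0n.
have em : 'X_[m] = 'X_i * 'X_[m - U_(i)] :> {mpoly k[n]}.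
  by rewrite -mpolyXD addmC submK.
have dm : mdeg (m - U_(i))%MM = d.
  by have := congr1 mdeg (submK le_im); rewrite mdegD mdeg1 hm addn1 => -[].
exists (fun j => q j + if j == i then p@_m *: 'X_[m - U_(i)] else 0).
  move=> j; apply: rpredD => //; case: eqP => _; last exact: rpred0.
  by apply: rpredZ; rewrite dhomogX; apply/eqP.
under [RHS]eq_bigr => j _ do rewrite mulrDr.
rewrite big_split /= addrC; congr (_ + _).
rewrite (bigD1 i) //= eqxx big1 ?addr0 => [|j /negPf->]; last by rewrite mulr0.
by rewrite em -scalerAr.
Qed.

Section Derivative.
Variables (n : nat) (v p : 'rV[k]_n).

(** The derivative of [F] at the point [p] in the direction [v]. *)
Definition dir_deriv (F : {mpoly k[n]}) : k := \sum_l v 0 l * peval F^`M(l) p.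

Lemma dir_deriv_mulX i q :
  dir_deriv ('X_i * q) = v 0 i * peval q p + p 0 i * dir_deriv q.
Proof.
have dX l : peval 'X_i^`M(l) p = (i == l)%:R.
  rewrite mderivX /peval mevalZ mnm1E; case: eqP => [->|_]; last by rewrite mul0r.
  rewrite (_ : (U_(l) - U_(l))%MM = 0%MM) ?mpolyX0 ?meval1 ?mulr1 //.
  by apply/mnmP => j; rewrite mnmBE mnm0E subnn.
rewrite /dir_deriv mulr_sumr.
under eq_bigr => l _ do
  rewrite mderivM pevalD !pevalM dX [peval 'X_i p]mevalXU mulrDr mulrCA.
rewrite big_split /= (bigD1 i) //= eqxx mulr1n big1 => [|l /negPf il].
  by rewrite addr0 mul1r; congr (_ + _); apply: eq_bigr => l _; rewrite mulrCA.
by rewrite eq_sym il mul0r.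
Qed.

Lemma dir_deriv_sum (q : 'I_n -> {mpoly k[n]}) :
  dir_deriv (\sum_i 'X_i * q i) =
  \sum_i (v 0 i * peval (q i) p + p 0 i * dir_deriv (q i)).
Proof.
rewrite -(eq_bigr _ (fun i _ => dir_deriv_mulX i (q i))) /dir_deriv exchange_big /=.
apply: eq_bigr => l _; rewrite -mulr_sumr; congr (_ * _).
by rewrite raddf_sum /peval raddf_sum.
Qed.

End Derivative.

Lemma dir_deriv0 n (v p : 'rV[k]_n) q : q \is 0.-homog -> dir_deriv v p q = 0.
Proof.
move=> /dhomogP hq; rewrite /dir_deriv big1 // => l _.
suff -> : q^`M(l) = 0 by rewrite /peval meval0 mulr0.
rewrite [q]mpolyE raddf_sum big_seq big1 // => m /hq /eqP.
rewrite mdeg_eq0 => /eqP-> /=.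
by rewrite mderivZ mderivX mnm0E scale0r scaler0.
Qed.

Section Multilinear.
Variable n : nat.
Local Notation V := 'rV[k]_n.

Definition linear_fun (f : V -> k) :=
  forall u v t, f (u + t *: v) = f u + t * f v.

Definition bilinear_fun (b : V -> V -> k) :=
  (forall w, linear_fun (b^~ w)) /\ (forall u, linear_fun (b u)).

Definition trilinear_fun (T : V -> V -> V -> k) :=
  (forall w, bilinear_fun (fun u v => T u v w)) /\
  (forall u v, linear_fun (T u v)).

Lemma linear_sum (I : finType) (c : I -> k) (f : I -> V -> k) :
  (forall i, linear_fun (f i)) -> linear_fun (fun v => \sum_i c i * f i v).
Proof.
move=> lf u v t; rewrite mulr_sumr -big_split; apply: eq_bigr => i _ /=.
by rewrite lf; ring.
Qed.

Lemma linear_coords (c : 'I_n -> k) : linear_fun (fun v => \sum_i v 0 i * c i).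
Proof.
move=> u v t; rewrite mulr_sumr -big_split; apply: eq_bigr => i _ /=.
by rewrite !mxE; ring.
Qed.

Lemma peval_sumX (q : 'I_n -> {mpoly k[n]}) v :
  peval (\sum_i 'X_i * q i) v = \sum_i v 0 i * peval (q i) v.
Proof.
rewrite /peval raddf_sum; apply: eq_bigr => i _.
by rewrite /= mevalM mevalXU.
Qed.

End Multilinear.

Lemma dhomog1_linear n (F : {mpoly k[n.+1]}) : F \is 1.-homog ->
  linear_fun (peval F) /\ forall v p, dir_deriv v p F = peval F v.
Proof.
move=> /dhomog_split[q hq ->].
(* A form of degree [0] is constant: scaling the argument by [0] multiplies its value by
   [0 ^ 0 = 1]. *)
have qc i v : peval (q i) v = peval (q i) 0.
  by rewrite -(scale0r v) (peval_scale _ _ (hq i)) expr0 mul1r.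
have ev v : peval (\sum_i 'X_i * q i) v = \sum_i v 0 i * peval (q i) 0.
  by rewrite peval_sumX; apply: eq_bigr => i _; rewrite qc.
split=> [u v t|v p]; first by rewrite !ev; apply: linear_coords.
rewrite dir_deriv_sum ev; apply: eq_bigr => i _.
by rewrite qc dir_deriv0 // mulr0 addr0.
Qed.

(** Splitting [F] as the sum of [X_i * q_i] with [q_i] linear gives [b u v], the sum of
    [u_i * q_i v]. It need not be symmetric, so both orders occur in the derivative. *)
Lemma dhomog2_bilinear n (F : {mpoly k[n.+1]}) : F \is 2.-homog ->
  exists b, [/\ bilinear_fun b, forall v, peval F v = b v v
    & forall v p, dir_deriv v p F = b v p + b p v].
Proof.
move=> /dhomog_split[q hq ->].
have lq i := dhomog1_linear (hq i).
exists (fun u v => \sum_i u 0 i * peval (q i) v); split.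
- by split=> w; [apply: linear_coords|apply: linear_sum => i; apply: (lq i).1].
- exact: peval_sumX.
- move=> v p; rewrite dir_deriv_sum -big_split; apply: eq_bigr => i _ /=.
  by rewrite (lq i).2.
Qed.

(** The same splitting one degree higher: the split variable is the first argument and the bilinear
    forms of the quadratic cofactors take the other two. *)
Lemma dhomog3_trilinear n (F : {mpoly k[n.+1]}) : F \is 3.-homog ->
  exists T, [/\ trilinear_fun T, forall v, peval F v = T v v v
    & forall v p, dir_deriv v p F = T v p p + T p v p + T p p v].
Proof.
move=> /dhomog_split[q hq ->].
have /choice[b hb] i := dhomog2_bilinear (hq i).
exists (fun u v w => \sum_i u 0 i * b i v w); split.
- split=> [w|u v]; last by apply: linear_sum => i; have [[]] := hb i.
  by split=> u; [apply: linear_coords|apply: linear_sum => i; have [[]] := hb i].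
- by move=> v; rewrite peval_sumX; apply: eq_bigr => i _; have [_ ->] := hb i.
- move=> v p; rewrite dir_deriv_sum -!big_split; apply: eq_bigr => i _ /=.
  by have [_ -> ->] := hb i; ring.
Qed.

Lemma row_neq0_coord n (v : 'rV[k]_n) : v != 0 -> exists j, v 0 j != 0.
Proof.
move=> v0; apply/existsP; apply: contraNT v0 => /existsPn H.
by apply/eqP/rowP => j; rewrite mxE; apply/eqP; have := H j; rewrite negbK.
Qed.

Lemma quadratic_zero (a b c : k) : c != 0 -> exists t, a + t * b + t ^+ 2 * c = 0.
Proof.
(* The monic equation [t ^ 2 = - a / c - (b / c) * t] has a root because [k] is algebraically
   closed. *)
move=> c0; have [t ht] := @solve_monicpoly k 2 (fun i => if i == 0%N then - a / c else - b / c) isT.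
exists t; rewrite ht !big_ord_recl big_ord0 /=; field.
exact: c0.
Qed.

Lemma linear_fun_zero n (f : 'rV[k]_n.+2 -> k) : linear_fun f ->
  exists2 w, w != 0 & f w = 0.
Proof.
move=> lf; pose e0 : 'rV[k]_n.+2 := delta_mx 0 0; pose e1 : 'rV[k]_n.+2 := delta_mx 0 1.
have [f1|f1] := eqVneq (f e1) 0.
  by exists e1 => //; apply/eqP => /rowP/(_ 1)/eqP; rewrite !mxE oner_eq0.
exists (e0 + (- f e0 / f e1) *: e1).
  apply/eqP => /rowP/(_ 0)/eqP.
  by rewrite !mxE /= mulr0 addr0 oner_eq0.
by rewrite lf; field.
Qed.

Lemma bilinear_expand n (b : 'rV[k]_n -> 'rV[k]_n -> k) v w t : bilinear_fun b ->
  b (v + t *: w) (v + t *: w) = b v v + t * (b v w + b w v) + t ^+ 2 * b w w.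
Proof. by move=> [b1 b2]; rewrite b1 !b2; ring. Qed.

(** If [e1] is not isotropic, the form restricted to [e0 + t e1] is a polynomial of degree exactly
    [2] in [t] and has a root. The vector found is nonzero since its coordinate [0] is [1]. *)
Lemma bilinear_fun_zero n (b : 'rV[k]_n.+2 -> 'rV[k]_n.+2 -> k) : bilinear_fun b ->
  exists2 w, w != 0 & b w w = 0.
Proof.
move=> bb; pose e0 : 'rV[k]_n.+2 := delta_mx 0 0; pose e1 : 'rV[k]_n.+2 := delta_mx 0 1.
have [f1|f1] := eqVneq (b e1 e1) 0.
  by exists e1 => //; apply/eqP => /rowP/(_ 1)/eqP; rewrite !mxE oner_eq0.
have [t ht] := quadratic_zero (b e0 e0) (b e0 e1 + b e1 e0) f1.
exists (e0 + t *: e1); last by rewrite bilinear_expand.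
apply/eqP => /rowP/(_ 0)/eqP.
by rewrite !mxE /= mulr0 addr0 oner_eq0.
Qed.

Lemma insert0_comb n j t (u v : 'rV[k]_n) :
  insert_coord j 0 (u + t *: v) = insert_coord j 0 u + t *: insert_coord j 0 v.
Proof. by rewrite -insert_coord_comb mulr0 addr0. Qed.

(** Along a nonzero kernel vector the slope is [0], so its zero set is a whole affine space of
    positive dimension. *)
Lemma linear_cone n (f : 'rV[k]_n.+2 -> k) : polynomial f -> linear_fun f ->
  eq_modL (qclass [set v | f v = 0]) K0_zero.
Proof.
move=> pf lf; have [w w0 fw] := linear_fun_zero lf.
have [j wj] := row_neq0_coord w0.
have fg v t : f (v + t *: w) = f v + t * 0 by rewrite lf fw.
apply: modL_opp_zero (qclass_zeros_affine (g := fun=> 0) pf wj fg) _.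
have -> : [set w : 'rV[k]_n.+1 | 0 = 0 :> k] = setT by apply/seteqP; split.
exact: qclass_space.
Qed.

(** Along an isotropic vector [w] the term in [t ^ 2] disappears, and the slope [b v w + b w v] is
    linear in [v]. *)
Lemma quadratic_cone n (b : 'rV[k]_n.+3 -> 'rV[k]_n.+3 -> k) :
  bilinear_fun b -> polynomial (fun v => b v v) ->
  eq_modL (qclass [set v | b v v = 0]) K0_zero.
Proof.
move=> bb pb; have [w w0 bw] := bilinear_fun_zero bb.
have [j wj] := row_neq0_coord w0.
have fg v t : b (v + t *: w) (v + t *: w) = b v v + t * (b v w + b w v).
  by rewrite bilinear_expand // bw mulr0 addr0.
apply: modL_opp_zero (qclass_zeros_affine (f := fun v => b v v) pb wj fg) _.
apply: linear_cone; first exact: (polynomial_insert0 (f := fun v => b v w + b w v) j (polynomial_slope pb fg)).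
have [b1 b2] := bb.
by move=> u v t; rewrite !insert0_comb b1 b2; ring.
Qed.

(** The last two hypotheses say that the cubic and its derivative vanish at [p]. They kill the
    coefficients of [t ^ 3] and [t ^ 2] in the direction [p], leaving a quadratic slope. *)
Lemma cubic_cone n (T : 'rV[k]_n.+4 -> 'rV[k]_n.+4 -> 'rV[k]_n.+4 -> k) p :
  trilinear_fun T -> polynomial (fun v => T v v v) -> p != 0 ->
  T p p p = 0 -> (forall v, T v p p + T p v p + T p p v = 0) ->
  eq_modL (qclass [set v | T v v v = 0]) K0_zero.
Proof.
move=> [T12 T3] pT p0 Tp Tv; have [j pj] := row_neq0_coord p0.
have T1 u v w x t : T (u + t *: v) w x = T u w x + t * T v w x.
  by have [H _] := T12 x; apply: H.
have T2 u v w x t : T w (u + t *: v) x = T w u x + t * T w v x.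
  by have [_ H] := T12 x; apply: H.
(* A bilinear form whose diagonal is the coefficient of [t] in the cubic at [v + t p]. *)
pose B u v := T u v p + T u p v + T p u v.
have fg v t : T (v + t *: p) (v + t *: p) (v + t *: p) = T v v v + t * B v v.
  transitivity (T v v v + t * B v v + t ^+ 2 * (T v p p + T p v p + T p p v)
     + t ^+ 3 * T p p p); last by rewrite Tv Tp !mulr0 !addr0.
  by rewrite !(T1, T2, T3) /B; ring.
apply: modL_opp_zero (qclass_zeros_affine (f := fun v => T v v v) pT pj fg) _.
apply: (@quadratic_cone n (fun u v => B (insert_coord j 0 u) (insert_coord j 0 v))).
  by split=> u v w t; rewrite insert0_comb /B !(T1, T2, T3); ring.
exact: (polynomial_insert0 (f := fun v => B v v) j (polynomial_slope pT fg)).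
Qed.

End Forms.

Theorem theorem3p2 (k : closedFieldType) (hk : [pchar k] =i pred0)
    (n : nat) (hn : (3 <= n)%N) (F : {mpoly k[n.+1]}) (hF0 : F != 0)
    (hF : F \is 3.-homog) (hsing : singular F) :
  L_rational (hypersurface hF).
Proof.
(* With [n >= 3] the cone lies in a space of dimension at least [4]: three descents, through degrees
   [3], [2] and [1], still leave positive dimension. *)
case: n hn F hF0 hF hsing => [|[|[|n]]] // _ F _ hF [x [Fx dFx]].
apply: L_rational_cone => //.
have [T [tT eF eD]] := dhomog3_trilinear hF.
have eT : peval F = (fun v => T v v v) by apply: funext.
rewrite (_ : [set v | peval F v = 0] = [set v | T v v v = 0]) ?eT //.
apply: (cubic_cone (p := hcoord x)) => //.
- by rewrite -eT; apply: polynomial_peval.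
- exact: hcoord_neq0.
- by rewrite -eF.
(* The sum of the three terms is the derivative of [F] at [p] in the direction [v], a combination of
   the vanishing partial derivatives. *)
- by move=> v; rewrite -eD /dir_deriv big1 // => l _; rewrite [peval _ _]dFx mulr0.
Qed.
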